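(* Let $a,b,c$ be nonnegative integers and let $r,s,t$ be integers with $0\le r\le a+2$, $0\le s\le b+2$, $0\le t\le c+2$. The number of plane partitions contained in an $(a+2)\times(b+2)\times(c+2)$-box having (exactly) $b+2-s$ entries equal to $c+2$ in the first row, (exactly) $r$ entries equal to $0$ in the last column, and $c+2-t$ as the bottom-left entry equals \begin{multline*} (r+1)_b (s+1)_c (t+1)_a (c+3-t)_b (a+3-r)_c (b+3-s)_a\, \frac{\prod_{k=0}^{a}k!\ \prod_{k=0}^{b}k!\ \prod_{k=0}^{c}k!\ \prod_{k=0}^{a+b+c+2}k!} {\prod_{k=0}^{b+c+2}k!\ \prod_{k=0}^{a+c+2}k!\ \prod_{k=0}^{a+b+2}k!}\\ \times\Big( (a+1)(b+1)(c+1)(a+2-r)(b+2-s)(c+2-t) + (a+1)(b+1)(c+1)\,r s t\\ - (a+2-r)(b+2-s)(c+2-t)\,r s t +(a+1)(c+1)(b+2-s)(c+2-t)\,r s\\ +(b+1)(a+1)(c+2-t)(a+2-r)\,s t +(c+1)(b+1)(a+2-r)(b+2-s)\,t r \Big). \end{multline*}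
   Context: Notation: $(x)_n=x(x+1)\cdots(x+n-1)$, with $(x)_0=1$. A plane partition contained in an $(a+2)\times(b+2)\times(c+2)$-box is a rectangular array of nonnegative integers $\le c+2$ with $a+2$ rows and $b+2$ columns, whose rows (read left to right) and columns (read top to bottom) are nonincreasing. The first row is the top row, the last column is the rightmost column, and the bottom-left entry is the entry in the last row and first column. *)

(* Defs.v *)
From HB Require Import structures.
From mathcomp Require Import all_boot all_order all_algebra.

Set Implicit Arguments.
Unset Strict Implicit.
Unset Printing Implicit Defensive.

Import Order.TTheory GRing.Theory Num.Theory.

Local Open Scope ring_scope.

Definition pochhammer (R : pzSemiRingType) (x : R) (n : nat) : R :=
  \prod_(i < n) (x + i%:R).

(* An array contained in an m x n x h box: m rows, n columns, entries at most h,
   hence of type 'I_h.+1.  Row ord0 is the top row, column ord0 the leftmost. *)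
Definition plane_partition (m n h : nat) (P : 'M['I_h.+1]_(m, n)) : bool :=
  [forall i : 'I_m, forall j1 : 'I_n, forall j2 : 'I_n,
     (j1 <= j2)%N ==> (P i j2 <= P i j1)%N]
  && [forall j : 'I_n, forall i1 : 'I_m, forall i2 : 'I_m,
     (i1 <= i2)%N ==> (P i2 j <= P i1 j)%N].

(* Main.v *)
Require Import Defs.
From HB Require Import structures.
From mathcomp Require Import all_boot all_order all_algebra.
From mathcomp Require Import zify ring lra.

Set Implicit Arguments.
Unset Strict Implicit.
Unset Printing Implicit Defensive.

Import Order.TTheory GRing.Theory Num.Theory.

Local Open Scope ring_scope.

(** Let A = a + 2, B = b + 2 and C = c + 2 be the sides of the box, fix s and t,
    and let N(r) be the number of plane partitions under consideration.

    Read from right to left, a row of a plane partition is a lattice path with B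
    horizontal and C vertical steps; shifting the path of row i by i turns the A
    rows into a family of nonintersecting paths.  The first step of a path is
    horizontal exactly when its row ends with 0, so that after one step the paths
    occupy A of the A + 1 positions 0, ..., A, and the free one is A - r.  Let
    phi_i(j) be the number of single paths that go from position j to the end of
    the path of row i in the remaining n = B + C - 1 steps, a binomial
    coefficient.  Then the sum over j of (-1)^j phi_i(j) N(A - j) vanishes: it is
    a signed count of families in which the path i occurs twice.  The
    determinant-free form of this is [wedge_completions]: wedging with one more
    free path commutes with moving all the paths by one step, and vanishes at the
    end, where the place is taken.  The values s and t only constrain the paths
    of the first and of the last row, and the relation survives for the a rows in
    between ([zeros_tops_corner_kernel]).

    Conversely, these a relations leave three degrees of freedom.  If N satisfies
    them and N(0) = N(A) = 0 and the sum of N is 0, then the polynomial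
    (1 + X)^n times the sum of the (-1)^j N(A - j) X^j has at most n + 1 nonzero
    terms, but -1 as a root of multiplicity at least n + 1; hence it is 0
    ([few_terms_eq0], [kernel_determined]).  The closed formula satisfies the
    relations because it is (r + 1)_b (a + 3 - r)_c times a polynomial of degree
    at most 2 in r, which makes each relation the A-th finite difference of a
    polynomial of degree less than A ([rising_kernel]).

    It remains to compare N(0), N(A) and the sum of N with the formula.  If r = 0
    then all entries are positive and can be lowered by 1; if r = A then the last
    column is 0 and can be dropped.  In both cases, and for the sum, only s and t
    are left.  Each parameter is the position of a border rhombus in the tiling
    of a hexagon that corresponds to the plane partition, and the counts with
    fewer fixed rhombi are treated in the same way, with more rows contributing
    relations and fewer boundary values needed, down to MacMahon's formula for
    all the plane partitions in a box.  The parameter that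
    is eliminated is always r: the cyclic rotation of the box ([rotate]) carries
    the pair (s, t) to the pair (r, s), and s to r. *)
(** * Wedge products and nonintersecting paths *)

(** The value at z of the exterior product of phi and g, where g stands for the
    alternating function that it determines on strictly increasing sequences. *)
Fixpoint wedge (phi : nat -> rat) (g : seq nat -> rat) (z : seq nat) : rat :=
  if z is p :: z' then phi p * g z' - wedge phi (fun y => g (p :: y)) z' else 0.

(** One simultaneous step of all the particles. *)
Fixpoint transfer (g : seq nat -> rat) (z : seq nat) : rat :=
  if z is p :: z' then
    transfer (fun y => g (p :: y)) z' + transfer (fun y => g (p.+1 :: y)) z'
  else g [::].

Lemma eq_wedge phi psi g h z :
  phi =1 psi -> g =1 h -> wedge phi g z = wedge psi h z.
Proof.
move=> phiE; elim: z g h => //= p z IHz g h ghE.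
by rewrite phiE ghE; congr (_ - _); apply: IHz => y; apply: ghE.
Qed.

Lemma wedgeD phi g h z :
  wedge phi (fun y => g y + h y) z = wedge phi g z + wedge phi h z.
Proof.
elim: z g h => /= [|p z IHz] g h; first by rewrite addr0.
by rewrite IHz; ring.
Qed.

Lemma transfer_lin c g h z :
  transfer (fun y => c * g y - h y) z = c * transfer g z - transfer h z.
Proof. by elim: z g h => //= p z IHz g h; rewrite !IHz; ring. Qed.

(** A step acts on alternating functions as an exterior power, hence is
    multiplicative; on a single particle it is phi p + phi p.+1.  The sum runs
    over all moves, also over those that make two particles collide. *)
Lemma wedge_transfer phi g z :
  wedge (fun p => phi p + phi p.+1) (transfer g) z = transfer (wedge phi g) z.
Proof.
elim: z g => //= p z IHz g.
by rewrite !transfer_lin wedgeD !IHz; ring.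
Qed.

(** When two neighbours of z coincide, their two terms cancel and all the
    other terms still see the coincidence. *)
Lemma wedge_weak phi g z : (forall y, ~~ sorted ltn y -> g y = 0) ->
  sorted leq z -> ~~ sorted ltn z -> wedge phi g z = 0.
Proof.
elim: z g => [//|p [//|q z] IHz] g g0 /= /andP[lepq zs].
rewrite negb_and -leqNgt => /orP[leqp|zNs].
  have <- : p = q by apply/eqP; rewrite eqn_leq lepq.
  have -> : wedge phi (fun y => g (p :: p :: y)) z = 0.
    rewrite (@eq_wedge _ phi _ (fun=> 0)) //; last first.
      by move=> y; apply: g0; rewrite /= ltnn.
    by elim: (z) => //= r u ->; rewrite mulr0 subr0.
  by rewrite subr0 subrr.
rewrite (g0 (q :: z)) // mulr0 add0r.
rewrite -[_ - _]/(wedge phi (fun y => g (p :: y)) (q :: z)) IHz ?oppr0 // => y yNs.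
apply: g0; case: y yNs => //= r y; by rewrite negb_and orbC => ->.
Qed.

Lemma wedge_sum phi g z : wedge phi g z =
  \sum_(j < size z) (-1) ^+ j * phi (nth 0%N z j) * g (take j z ++ drop j.+1 z).
Proof.
elim: z g => /= [|p z IHz] g; first by rewrite big_ord0.
rewrite big_ord_recl /= expr0 mul1r drop0 IHz -sumrN; congr (_ + _).
by apply: eq_bigr => j _; rewrite /= add0n exprS; ring.
Qed.

(** Each term of the wedge product sees z without one of its entries, and only
    the terms count for which phi does not vanish at that entry. *)
Lemma wedge_if phi (chi : pred (seq nat)) (b : bool) g z :
    (forall j, (j < size z)%N -> phi (nth 0%N z j) != 0 ->
       chi (take j z ++ drop j.+1 z) = b) ->
  wedge phi (fun y => if chi y then g y else 0) z = if b then wedge phi g z else 0.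
Proof.
move=> chiE; rewrite !wedge_sum.
have -> : (if b then \sum_(j < size z)
    (-1) ^+ j * phi (nth 0%N z j) * g (take j z ++ drop j.+1 z) else 0) =
   \sum_(j < size z) if b then
    (-1) ^+ j * phi (nth 0%N z j) * g (take j z ++ drop j.+1 z) else 0.
  by case: b {chiE} => //; rewrite big1.
apply: eq_bigr => j _; have [->|nz] := eqVneq (phi (nth 0%N z j)) 0.
  by rewrite mulr0 !mul0r; case: b {chiE}.
by rewrite chiE //; case: ifP; rewrite ?mulr0.
Qed.

Lemma subseq_take_drop (T : eqType) (z : seq T) j :
  subseq (take j z ++ drop j.+1 z) z.
Proof.
rewrite -{3}(cat_take_drop j z); apply: cat_subseq => //.
by rewrite -addn1 addnC -drop_drop drop_subseq.
Qed.

(** A step from a strictly increasing sequence leads to weakly increasing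
    ones only. *)
Lemma transfer0 g z :
    (forall y, size y = size z -> sorted leq y -> g y = 0) ->
  sorted ltn z -> transfer g z = 0.
Proof.
(* The bound l on the entries makes the induction on z go through. *)
have gen : forall z g (l : nat),
    (forall y, size y = size z -> path leq l y -> g y = 0) ->
    path leq l z -> sorted ltn z -> transfer g z = 0.
  elim=> {z g} [|p z IHz] g l g0 /= => [_ _|/andP[lep _] pz]; first exact: g0.
  have zs := path_sorted pz; have pz' : path leq p.+1 z.
    by case: (z) pz => //= q u /andP[-> qu]; apply: sub_path qu => x y /ltnW.
  rewrite (IHz _ p) ?(IHz _ p.+1) ?addr0 //.
  - by move=> y sy py; apply: g0; rewrite /= ?sy // (leq_trans lep).
  - by move=> y sy py; apply: g0; rewrite /= ?sy // lep.
  by apply: sub_path pz => x y /ltnW.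
move=> g0 zs; apply: (gen _ _ 0%N) => // [y sy py|].
  by apply: g0 => //; apply: path_sorted py.
case: (z) zs => //= p u pu; apply: sub_path pu => x y; exact: ltnW.
Qed.

(** The number of ways to go from p to f in n steps, each of size 0 or 1. *)
Definition reaches (n p f : nat) : nat := if (p <= f)%N then 'C(n, f - p) else 0%N.

Lemma reachesS n p f : reaches n.+1 p f = (reaches n p f + reaches n p.+1 f)%N.
Proof.
rewrite /reaches; case: (ltngtP p f) => [ltpf|//|->]; last by rewrite subnn !bin0.
by rewrite -[(f - p)%N]prednK ?subn_gt0 // binS subnS addnC.
Qed.

(** What the conditions on the first row (k) and on the last row (t) demand m
    steps before the end.  The particle of that row has to be in an extreme
    position, which forces its path from there to the end.  The default values
    make the demands void for A = 0. *)
Definition barrier (A B k t m : nat) (z : seq nat) : bool :=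
  ((m == k) ==> (nth (B - k)%N z 0 == B - k)%N) &&
  ((m == t) ==> (last (B + A).-1 z == (B + A).-1)).

Definition final_state (A B : nat) : seq nat := [seq (B + i)%N | i <- iota 0 A].

(** The number of ways in which A particles at z reach the final state in m
    steps without collision and respecting the barriers. *)
Fixpoint completions (A B k t m : nat) (z : seq nat) : rat :=
  if m is m'.+1 then
    if sorted ltn z && barrier A B k t m z
    then transfer (completions A B k t m') z else 0
  else (z == final_state A B)%:R.

Lemma completions_strict A B k t m z :
  ~~ sorted ltn z -> completions A B k t m z = 0.
Proof.
case: m => [|m] /= zNs; last by rewrite (negbTE zNs).
case: eqP zNs => // ->; case/negP.
rewrite /final_state sorted_map; apply: sub_sorted (iota_ltn_sorted 0 A).
by move=> x y /=; rewrite ltn_add2l.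
Qed.

Lemma ltn_nth_sorted z i j : sorted ltn z -> (i < j < size z)%N ->
  (nth 0%N z i < nth 0%N z j)%N.
Proof.
move=> zs /andP[ij jz].
by apply: (sorted_ltn_nth ltn_trans 0 zs); rewrite ?inE // (ltn_trans ij).
Qed.

Lemma nth_take_drop z j i : nth 0%N (take j z ++ drop j.+1 z) i =
  if (i < j)%N && (j < size z)%N then nth 0%N z i
  else if (j < size z)%N then nth 0%N z i.+1 else nth 0%N z i.
Proof.
have [jz|zj] := ltnP j (size z); last first.
  by rewrite andbF take_oversize // drop_oversize ?cats0 // ltnW.
rewrite andbT nth_cat size_take jz nth_drop.
case: ltnP => [ij|ji]; first by rewrite nth_take.
by rewrite addSn subnKC.
Qed.

Lemma size_take_drop (z : seq nat) j : (j < size z)%N ->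
  size (take j z ++ drop j.+1 z) = (size z).-1.
Proof. by move=> jz; rewrite size_cat size_take size_drop jz; lia. Qed.

(** The path of particle i, counted without regard to the others, wedged with
    the families: at the end both want the same place, and the steps preserve
    the vanishing.  So do the barriers: if the particle constrained by a barrier
    is not i, the single path cannot pass through the place of the barrier or
    beyond it. *)
Theorem wedge_completions A B k t i m z :
    (i < A)%N -> (k <= B)%N -> (i = 0%N -> k = 0%N) -> (i.+1 = A -> t = 0%N) ->
    sorted ltn z -> size z = A.+1 ->
  wedge (fun p => (reaches m p (B + i))%:R) (completions A B k t m) z = 0.
Proof.
move=> iA kB ik0 it0; elim: m z => [|m IHm] z zs sz.
  rewrite wedge_sum big1 // => j _ /=.
  have [ziE|ziN] := eqVneq (nth 0%N z j) (B + i)%N; last first.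
    rewrite /reaches; case: leqP => [le|]; last by rewrite mulr0 mul0r.
    have -> : (B + i - nth 0%N z j = (B + i - nth 0%N z j).-1.+1)%N by lia.
    by rewrite bin0n mulr0 mul0r.
  case: eqP => [delE|]; last by rewrite mulr0.
  have/(congr1 (nth 0%N ^~ i)) := delE.
  rewrite (nth_map 0%N) ?size_iota // nth_iota // add0n nth_take_drop ltn_ord andbT.
  case: ltnP => ij E.
    have := @ltn_nth_sorted z i j zs; rewrite E ziE ij ltn_ord; lia.
  have iz : (i.+1 < size z)%N by rewrite sz.
  by have := @ltn_nth_sorted z j i.+1 zs; rewrite E ziE ltnS ij iz ltnn => /(_ isT).
have -> : wedge (fun p => (reaches m.+1 p (B + i))%:R) (completions A B k t m.+1) z =
  wedge (fun p => (reaches m.+1 p (B + i))%:R)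
    (fun y => if barrier A B k t m.+1 y then transfer (completions A B k t m) y else 0) z.
  rewrite !wedge_sum; apply: eq_bigr => j _ /=; congr (_ * _).
  by rewrite (subseq_sorted ltn_trans (subseq_take_drop z j) zs).
have zk p : reaches m.+1 p (B + i) != 0 -> (p <= B + i <= p + m.+1)%N.
  rewrite /reaches; case: leqP => //= le; rewrite -lt0n bin_gt0; lia.
have nr0 (n : nat) : n%:R != 0 :> rat -> n != 0%N by rewrite pnatr_eq0.
rewrite (@wedge_if _ _ (barrier A B k t m.+1 z)); last first.
  move=> j jz /nr0 /zk zj; have jA : (j < A.+1)%N by rewrite -sz.
  rewrite /barrier; congr (_ && _).
    case: eqP => //= mk.
    rewrite (set_nth_default 0%N (B - k)%N) ?size_take_drop ?sz ?(leq_trans _ iA) //.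
    rewrite [in RHS](set_nth_default 0%N (B - k)%N) ?sz //.
    rewrite nth_take_drop jz andbT; case: ltnP => // j0.
    have j00 : j = 0%N by lia.
    move: zj; rewrite j00.
    have := @ltn_nth_sorted z 0 1 zs; rewrite sz; lia.
  case: eqP => //= mt.
  rewrite -!nth_last (set_nth_default 0%N (B + A).-1) ?size_take_drop ?sz //=; last lia.
  rewrite [in RHS](set_nth_default 0%N (B + A).-1) ?sz //.
  rewrite nth_take_drop jz andbT prednK ?(leq_trans _ iA) //.
  case: ltnP => // Aj.
  have jA' : j = A by lia.
  move: zj; rewrite jA'.
  have := @ltn_nth_sorted z A.-1 A zs; rewrite sz; lia.
case: ifP => // _.
rewrite (@eq_wedge _ (fun p => (reaches m p (B + i))%:R + (reaches m p.+1 (B + i))%:R) _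
   (transfer (completions A B k t m))) //; last by move=> p; rewrite reachesS natrD.
rewrite (wedge_transfer (fun p => (reaches m p (B + i))%:R)).
apply: transfer0 => // y sy ys.
have [yl|yl] := boolP (sorted ltn y); first by apply: IHm; rewrite ?sy.
by apply: wedge_weak => // u uN; apply: completions_strict.
Qed.
(** * Polynomials with a root of high multiplicity at -1 *)

(** Multiplying the coefficients of u by d amounts to 'X * u^`(), which costs
    one factor 'X + 1; the last factor kills the alternating sum. *)
Lemma alternating_annihilates (p u : {poly rat}) N : (size u <= N)%N ->
    ('X + 1) ^+ size p %| u ->
  \sum_(d < N) (-1) ^+ d * u`_d * p.[d%:R] = 0.
Proof.
elim/poly_ind: p u N => [|p c IHp] u N uN.
  by rewrite big1 // => d _; rewrite horner0 mulr0.
rewrite size_MXaddC; case: ifP => [/andP[/eqP-> /eqP->] _|_ dvu].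
  by rewrite big1 // => d _; rewrite mul0r addr0 horner0 mulr0.
have -> : \sum_(d < N) (-1) ^+ d * u`_d * (p * 'X + c%:P).[d%:R] =
    \sum_(d < N) (-1) ^+ d * ('X * u^`())`_d * p.[d%:R] +
    c * \sum_(d < N) u`_d * (-1) ^+ d.
  rewrite mulr_sumr -big_split; apply: eq_bigr => -[[|d] dN] _ /=.
    by rewrite hornerMXaddC coefXM /= expr0; ring.
  by rewrite hornerMXaddC coefXM /= coef_deriv -mulr_natr; ring.
have [v def_u] := dvdpP _ _ dvu.
rewrite -horner_coef_wide // IHp ?add0r.
- by rewrite def_u exprS mulrCA hornerM hornerD hornerX hornerC addNr mul0r mulr0.
- have [->|u'0] := eqVneq (u^`()) 0; first by rewrite mulr0 size_poly0.
  rewrite mulrC size_mulX // (leq_trans _ uN) //.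
  by apply: lt_size_deriv; apply: contraNneq u'0 => ->; rewrite deriv0.
rewrite def_u derivM deriv_exp derivD derivX derivC addr0 mul1r exprS /=.
apply: dvdp_mull; apply: dvdp_add; first by rewrite mulrA dvdp_mulIr.
by rewrite mulrnAr -mulrnAl dvdp_mulIr.
Qed.

(** If S contained the support of a nonzero u, a polynomial vanishing on all of S
    but one exponent of u would single out that coefficient in the alternating
    sum of [alternating_annihilates]. *)
Lemma few_terms_eq0 (u : {poly rat}) (S : seq nat) :
  ('X + 1) ^+ size S %| u -> (forall d, u`_d != 0 -> d \in S) -> u = 0.
Proof.
move=> dvu supp; apply/polyP => d0; rewrite coef0; apply/eqP/negPn/negP => nz.
have d0S := supp _ nz.
pose p : {poly rat} := \prod_(a <- [seq a <- S | a != d0]) ('X - (a%:R)%:P).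
have pS : (size p <= size S)%N.
  rewrite size_prod_XsubC size_filter -[X in (_ <= X)%N](count_predC (pred1 d0)).
  by rewrite -addn1 addnC leq_add2r -has_count has_pred1.
have := alternating_annihilates (leq_maxl (size u) d0.+1) (dvdp_trans (dvdp_exp2l _ pS) dvu).
have d0N : (d0 < maxn (size u) d0.+1)%N by rewrite leq_max ltnSn orbT.
rewrite (bigD1 (Ordinal d0N)) //= big1 ?addr0 => [|d dd0].
  apply/eqP; rewrite mulf_neq0 ?mulf_neq0 ?signr_eq0 //.
  rewrite horner_prod prodf_seq_neq0; apply/allP => a.
  rewrite mem_filter => /andP[ad0 _]; apply/implyP => _.
  by rewrite hornerXsubC subr_eq0 eqr_nat eq_sym.
have [->|/supp dS] := eqVneq (u`_d) 0; first by rewrite mulr0 mul0r.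
rewrite horner_prod (big_rem (d : nat)) /= ?hornerXsubC ?subrr ?mul0r ?mulr0 //.
by rewrite mem_filter dS andbT.
Qed.

Lemma coef_XD1n n d : (('X + 1 : {poly rat}) ^+ n)`_d = 'C(n, d)%:R.
Proof.
rewrite exprD1n coef_sum; have [dn|nd] := leqP d n.
  rewrite (bigD1 (Ordinal (dn : (d < n.+1)%N))) //= coefMn coefXn eqxx big1 ?addr0 //.
  move=> i id; rewrite coefMn coefXn; case: eqP => [E|]; last by rewrite mul0rn.
  by case/eqP: id; apply: val_inj.
rewrite bin_small // big1 // => i _; rewrite coefMn coefXn.
by case: eqP => [E|]; rewrite ?mul0rn //; have := ltn_ord i; lia.
Qed.

(** The sums are the coefficients of (1 + X)^n times the polynomial with
    coefficients (-1)^j E j.  This product has degree at most n + A, and too many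
    of its coefficients vanish for the multiplicity n + b of its root -1. *)
Lemma kernel_trivial n A (E : nat -> rat) (Z : seq nat) (b : bool) :
    uniq Z -> (A < size Z + b)%N ->
    (forall d, d \in Z -> (d <= n + A)%N /\
      \sum_(j < A.+1) (-1) ^+ j * (reaches n j d)%:R * E j = 0) ->
    (b -> \sum_(j < A.+1) E j = 0) ->
  forall j, (j <= A)%N -> E j = 0.
Proof.
move=> uZ szZ Z0 sumE.
pose e := \poly_(j < A.+1) ((-1) ^+ j * E j).
pose u := e * ('X + 1) ^+ n.
have ud d : u`_d = \sum_(j < A.+1) (-1) ^+ j * (reaches n j d)%:R * E j.
  rewrite /u mulrC coefMr.
  under eq_bigr => j _ do rewrite coef_XD1n coef_poly.
  rewrite -(big_mkord xpredT (fun j =>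
    'C(n, d - j)%:R * (if (j < A.+1)%N then (-1) ^+ j * E j else 0))).
  rewrite -(big_mkord xpredT (fun j => (-1) ^+ j * (reaches n j d)%:R * E j)).
  pose M := maxn d.+1 A.+1.
  rewrite (big_nat_widen _ _ M) ?leq_maxl // [RHS](big_nat_widen _ _ M) ?leq_maxr //.
  rewrite big_mkcond [RHS]big_mkcond; apply: eq_bigr => j _ /=; rewrite /reaches !ltnS.
  by have [jd|jd] := leqP j d; have [jA|jA] := leqP j A; ring.
have u0 : u = 0.
  apply: (@few_terms_eq0 _ [seq d <- iota 0 (n + A).+1 | d \notin Z]).
    (* n + A + 1 exponents, without the more than A - b elements of Z *)
    have szS : (size [seq d <- iota 0 (n + A).+1 | d \notin Z] <= n + b)%N.
      rewrite size_filter; set c := count _ _.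
      have := count_predC (mem Z) (iota 0 (n + A).+1); rewrite -/c size_iota.
      have -> : count (mem Z) (iota 0 (n + A).+1) = size Z.
        rewrite -size_filter; apply: perm_size; apply: uniq_perm => //.
          by rewrite filter_uniq ?iota_uniq.
        move=> d; rewrite mem_filter mem_iota add0n; apply/andP/idP => [[]//|dZ].
        by split=> //; rewrite ltnS; case: (Z0 d dZ).
      lia.
    apply: dvdp_trans (dvdp_exp2l _ szS) _; rewrite exprD mulrC /u.
    apply: dvdp_mul => //; case: b sumE {szZ szS} => [/(_ isT) sumE|_]; last first.
      by rewrite expr0 dvd1p.
    have -> : 'X + 1 = 'X - (- 1)%:P :> {poly rat} by rewrite polyCN opprK polyC1.
    rewrite expr1 dvdp_XsubCl; apply/eqP.
    rewrite (horner_coef_wide _ (size_poly _ _)) -[RHS]sumE; apply: eq_bigr => j _.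
    rewrite coef_poly ltn_ord mulrC mulrA -exprMn_comm; last exact: mulrC.
    by rewrite mulN1r opprK expr1n mul1r.
  move=> d; apply: contraNT => dS; rewrite ud; apply/eqP.
  have [dZ|dNZ] := boolP (d \in Z); first by case: (Z0 d dZ).
  rewrite big1 // => j _; rewrite /reaches; case: leqP => [jd|_]; last by rewrite mulr0 mul0r.
  rewrite bin_small ?mulr0 ?mul0r //.
  move: dS; rewrite mem_filter dNZ mem_iota /=; have := ltn_ord j; lia.
have e0 : e = 0.
  apply/eqP; move/eqP: u0; rewrite mulf_eq0 expf_eq0 => /orP[//|/andP[_]].
  by have := monic_neq0 (monicXaddC (1 : rat)); rewrite polyC1 => /negbTE->.
move=> j jA; have : e`_j = 0 by rewrite e0 coef0.
by rewrite coef_poly ltnS jA => /eqP; rewrite mulf_eq0 signr_eq0 => /eqP.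
Qed.

(** The rising factorial (m + 1)(m + 2)...(m + k). *)
Definition rising (m k : nat) : rat := ((m + k)`!)%:R / (m`!)%:R.

Lemma factr_neq0 m : (m`!)%:R != 0 :> rat.
Proof. by rewrite pnatr_eq0 -lt0n fact_gt0. Qed.

Lemma natr_ffact m e : ((m ^_ e)%N)%:R = \prod_(i < e) (m%:R - i%:R) :> rat.
Proof.
elim: e => [|e IHe]; first by rewrite big_ord0.
rewrite big_ord_recr -IHe ffactnSr natrM /=.
have [em|me] := leqP e m; first by rewrite natrB.
by rewrite ffact_small // !mul0r.
Qed.

(** Clearing the denominators of the binomial coefficient leaves 'C(A, j) times
    polynomials in j of degrees e and f; where the binomial coefficient is cut
    off, one of the two falling factorials vanishes. *)
Lemma reaches_rising beta gamma d e f n A j :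
    (j <= A)%N -> (d + e = beta + A)%N -> (n + f = d + gamma)%N ->
  (reaches n j d)%:R * (rising (A - j) beta * rising j gamma) =
  n`!%:R / A`!%:R * 'C(A, j)%:R * (((A - j + beta) ^_ e)%N)%:R
    * (((j + gamma) ^_ f)%N)%:R.
Proof.
move=> jA de nf; rewrite /reaches /rising.
have binE (a b : nat) : (b <= a)%N -> 'C(a, b)%:R = a`!%:R / (b`!%:R * (a - b)`!%:R) :> rat.
  by move=> ba; rewrite -(bin_fact ba) !natrM mulfK // mulf_neq0 ?factr_neq0.
have ffE (a b : nat) : (b <= a)%N -> (a ^_ b)%:R = a`!%:R / (a - b)`!%:R :> rat.
  by move=> ba; rewrite -(ffact_fact ba) !natrM mulfK ?factr_neq0.
have [jd|dj] := leqP j d; last first.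
  by rewrite (@ffact_small (A - j + beta)) ?mulr0 ?mul0r //; lia.
have [djn|ndj] := leqP (d - j) n; last first.
  by rewrite bin_small // (@ffact_small (j + gamma)) ?mulr0 ?mul0r //; lia.
rewrite !binE // !ffE; [|lia|lia].
have -> : (A - j + beta - e = d - j)%N by lia.
have -> : (n - (d - j) = j + gamma - f)%N by lia.
by field; rewrite !factr_neq0.
Qed.

Lemma size_prod_ord (c : nat -> rat) e :
  size (\prod_(i < e) ('X - (c i)%:P)) = e.+1.
Proof.
by rewrite -(big_mkord xpredT (fun i => 'X - (c i)%:P)) size_prod_XsubC size_iota subn0.
Qed.

(** By [reaches_rising] the sum is an A-th finite difference of a polynomial
    of degree less than A. *)
Lemma rising_kernel beta gamma d e f n A (q : {poly rat}) :
    (d + e = beta + A)%N -> (n + f = d + gamma)%N -> (size q + e + f <= A)%N ->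
  \sum_(j < A.+1) (-1) ^+ j * (reaches n j d)%:R *
    (rising (A - j) beta * rising j gamma * q.[j%:R]) = 0.
Proof.
move=> de nf sq.
have [->|q0] := eqVneq q 0.
  by rewrite big1 // => j _; rewrite horner0 !mulr0.
pose pe : {poly rat} := \prod_(i < e) ((A + beta)%:R%:P - i%:R%:P - 'X).
pose pf : {poly rat} := \prod_(i < f) ('X + (gamma%:R%:P - i%:R%:P)).
pose p := pe * pf * q.
have spe : size pe = e.+1.
  have -> : pe = (-1) ^+ e *: \prod_(i < e) ('X - ((A + beta)%:R - i%:R)%:P).
    rewrite -[X in (-1) ^+ X]card_ord -mul_polyC polyC_exp polyCN polyC1.
    rewrite -prodr_const -big_split; apply: eq_bigr => i _ /=; rewrite polyCB; ring.
  by rewrite size_scale ?signr_eq0 // (size_prod_ord (fun i => (A + beta)%:R - i%:R)).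
have spf : size pf = f.+1.
  have -> : pf = \prod_(i < f) ('X - (- (gamma%:R - i%:R))%:P).
    by apply: eq_bigr => i _; rewrite polyCN polyCB; ring.
  by rewrite (size_prod_ord (fun i => - (gamma%:R - i%:R))).
have pe0 : pe != 0 by rewrite -size_poly_eq0 spe.
have pf0 : pf != 0 by rewrite -size_poly_eq0 spf.
have sp : (size p <= A)%N.
  rewrite /p size_mul ?mulf_neq0 // size_mul // spe spf addnS /=.
  by rewrite addnC addnA.
have sN : (size (('X + 1 : {poly rat}) ^+ A) <= A.+1)%N.
  by apply/leq_sizeP => i Ai; rewrite coef_XD1n bin_small.
have := alternating_annihilates sN (dvdp_exp2l _ sp) => sum0.
rewrite -[RHS](mulr0 (n`!%:R / A`!%:R)) -[in RHS]sum0 mulr_sumr.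
apply: eq_bigr => j _.
have jA : (j <= A)%N by rewrite -ltnS.
rewrite [LHS]mulrA -[_ * _ * (rising _ _ * _)]mulrA (reaches_rising jA de nf) coef_XD1n.
rewrite !natr_ffact /p !hornerM !horner_prod.
have -> : \prod_(i < e) ((A + beta)%:R%:P - i%:R%:P - 'X).[j%:R] =
    \prod_(i < e) ((A - j + beta)%:R - i%:R) :> rat.
  by apply: eq_bigr => i _; rewrite !hornerE !natrD natrB //; ring.
have -> : \prod_(i < f) ('X + (gamma%:R%:P - i%:R%:P)).[j%:R] =
    \prod_(i < f) ((j + gamma)%:R - i%:R) :> rat.
  by apply: eq_bigr => i _; rewrite !hornerE !natrD //; ring.
ring.
Qed.
(** * Plane partitions as families of lattice paths *)

Lemma card_bij_on (T U : finType) (X : {set T}) (Y : {set U}) f g :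
    (forall x, x \in X -> f x \in Y /\ g (f x) = x) ->
    (forall y, y \in Y -> g y \in X /\ f (g y) = y) -> #|X| = #|Y|.
Proof.
move=> fP gP; have -> : Y = f @: X.
  apply/setP => y; apply/idP/imsetP => [yY|[x xX ->]]; last by case: (fP x xX).
  by exists (g y); case: (gP y yY).
rewrite card_in_imset // => x y xX yX fxy.
by case: (fP x xX) (fP y yX) => _ <- [_ <-]; rewrite fxy.
Qed.

Lemma plane_partitionP m n h (P : 'M['I_h.+1]_(m, n)) :
  reflect ((forall (i : 'I_m) (j1 j2 : 'I_n), (j1 <= j2)%N -> (P i j2 <= P i j1)%N) /\
           (forall (j : 'I_n) (i1 i2 : 'I_m), (i1 <= i2)%N -> (P i2 j <= P i1 j)%N))
          (plane_partition P).
Proof.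
apply: (iffP andP) => -[rP cP]; split.
- by move=> i j1 j2; move/forallP/(_ i)/forallP/(_ j1)/forallP/(_ j2)/implyP: rP; apply.
- by move=> j i1 i2; move/forallP/(_ j)/forallP/(_ i1)/forallP/(_ i2)/implyP: cP; apply.
- by do 3!apply/forallP=> ?; apply/implyP; apply: rP.
- by do 3!apply/forallP=> ?; apply/implyP; apply: cP.
Qed.

Lemma forall2P (I J : finType) (b : I -> J -> bool) :
  reflect (forall i j, b i j) [forall i, forall j, b i j].
Proof. by apply: (iffP forallP) => [H i j|H i]; [have/forallP := H i|apply/forallP]. Qed.

(** Stated so that it is void if there is no row. *)
Definition run A B C (k : nat) (P : 'M['I_C.+1]_(A, B)) : bool :=
  [forall i : 'I_A, forall j : 'I_B,
     ((i : nat) == 0%N) && (j < k)%N ==> (P i j == C :> nat)].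

(** Stated so that it is void if there is no bottom-left entry. *)
Definition low A B C (t : nat) (P : 'M['I_C.+1]_(A, B)) : bool :=
  [forall i : 'I_A, forall j : 'I_B,
     (i.+1 == A) && (j == 0%N :> nat) ==> (P i j + t <= C)%N].

(** What the path family that occupies z after tau steps knows about P.  Row i
    has made nth 0 z i - i horizontal steps; the entries read so far are replaced
    by 0, and the entries still to be read are at least as large as the height
    reached. *)
Definition prefix_cond A B C tau (z : seq nat) (P : 'M['I_C.+1]_(A, B)) : bool :=
  [forall i : 'I_A, forall j : 'I_B,
     if (B + i <= j + nth 0%N z i)%N then P i j == 0%N :> nat
     else (tau + i <= P i j + nth 0%N z i)%N].

(** Plane partitions that represent the completions of z with m steps left: the
    part of each path that is over is normalised to consist of zeros. *)
Definition partials A B C k t m z : {set 'M['I_C.+1]_(A, B)} :=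
  [set P | [&& plane_partition P, [forall i : 'I_A, nth 0%N z i <= B + i]%N,
     prefix_cond (B + C - m) z P, (k <= m)%N ==> run k P & (t <= m)%N ==> low t P]].

Lemma strict_gap z i j : sorted ltn z -> (i <= j < size z)%N ->
  (nth 0%N z i + (j - i) <= nth 0%N z j)%N.
Proof.
move=> zs; elim: j => [|j IHj] /andP[ij jz].
  by move: ij; rewrite leqn0 => /eqP->; rewrite addn0.
have [->|ij'] := eqVneq i j.+1; first by rewrite subnn addn0.
have := @ltn_nth_sorted z j j.+1 zs; rewrite ltnSn jz => /(_ isT).
have := IHj; have -> /= : (i <= j < size z)%N by lia.
move=> /(_ isT); lia.
Qed.

Definition shift (z : seq nat) (e : seq bool) : seq nat :=
  [seq (x.1 + nat_of_bool x.2)%N | x <- zip z e].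

Lemma nth_shift z e i : size z = size e ->
  nth 0%N (shift z e) i = (nth 0%N z i + nth false e i)%N.
Proof.
move=> ze; have [iz|zi] := ltnP i (size z).
  by rewrite (nth_map (0%N, false)) ?size_zip -?ze ?minnn // nth_zip.
by rewrite !nth_default ?size_map ?size_zip -?ze ?minnn.
Qed.

Lemma transfer_sum g z n : size z = n ->
  transfer g z = \sum_(e : n.-tuple bool) g (shift z e).
Proof.
move=> <-; elim: z g => [|p z IHz] g /=.
  rewrite (bigD1 [tuple]) //= big1 ?addr0 // => e /eqP[]; exact: tuple0.
rewrite !IHz.
have -> : \sum_(e : (size z).+1.-tuple bool) g (shift (p :: z) e) =
  \sum_(x : bool * (size z).-tuple bool) g ((p + x.1)%N :: shift z x.2).
  rewrite (reindex (fun x : bool * (size z).-tuple bool => [tuple of x.1 :: x.2])) //=.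
  exists (fun e => (thead e, [tuple of behead e])) => [[b e] _|e _] /=.
    by congr (_, _); apply: val_inj.
  by rewrite [RHS]tuple_eta.
rewrite -(pair_bigA _ (fun (b : bool) (e : (size z).-tuple bool) =>
  g ((p + b)%N :: shift z e))) /=.
by rewrite big_bool /= addrC addn0 addn1.
Qed.

Section Step.

Variables (A B C k t m : nat) (z : seq nat).
Hypotheses (C_gt0 : (0 < C)%N) (mBC : (m < B + C)%N).
Hypotheses (zs : sorted ltn z) (sz : size z = A).
Hypothesis zle : forall i, (i < A)%N -> (nth 0 z i <= (B + C - m.+1) + i)%N.

Let tau := (B + C - m.+1)%N.
Let side_conditions (P : 'M['I_C.+1]_(A, B)) :=
  ((k <= m)%N ==> run k P) && ((t <= m)%N ==> low t P).

Definition horizontal (e : seq bool) (i : 'I_A) (j : 'I_B) :=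
  nth false e i && ((j + nth 0%N z i).+1 == B + i)%N.

(** Normalises the entries that have just been read. *)
Definition erase e (P : 'M['I_C.+1]_(A, B)) : 'M['I_C.+1]_(A, B) :=
  \matrix_(i, j) if horizontal e i j then ord0 else P i j.

Definition restore e (P : 'M['I_C.+1]_(A, B)) : 'M['I_C.+1]_(A, B) :=
  \matrix_(i, j) if horizontal e i j then inord (tau + i - nth 0%N z i) else P i j.

(** The rows whose path makes a horizontal step next, namely those whose next
    entry equals the height reached. *)
Definition moves (P : 'M['I_C.+1]_(A, B)) : A.-tuple bool :=
  [tuple [exists j : 'I_B, ((j + nth 0%N z i).+1 == B + i)%N &&
       (P i j + nth 0%N z i == tau + i)%N] | i < A].

Lemma nth_moves P (i : 'I_A) : nth false (moves P) i =
  [exists j : 'I_B, ((j + nth 0%N z i).+1 == B + i)%N &&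
       (P i j + nth 0%N z i == tau + i)%N].
Proof. by rewrite -tnth_nth tnth_mktuple. Qed.

Lemma le_nth (i : 'I_A) : (i <= nth 0%N z i)%N.
Proof.
have iA := ltn_ord i.
have /= := @strict_gap z 0 i zs; rewrite sz iA subn0 => /(_ isT); lia.
Qed.

Let S := partials A B C k t m.
Let S' := [set P : 'M['I_C.+1]_(A, B) |
  [&& plane_partition P, [forall i : 'I_A, nth 0%N z i <= B + i]%N,
     prefix_cond tau z P & side_conditions P]].

(** Particles do not collide, as the columns of P are nonincreasing. *)
Lemma moves_strict P : P \in S' -> sorted ltn (shift z (moves P)).
Proof.
rewrite inE => /and4P[/plane_partitionP[rP cP] /forallP zB /forall2P PP _].
apply/(sortedP 0%N) => i; rewrite size_map size_zip size_tuple sz minnn => iA.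
have iA' : (i < A)%N by apply: ltnW.
rewrite !nth_shift ?size_tuple //.
have := @ltn_nth_sorted z i i.+1 zs; rewrite ltnSn sz iA => /(_ isT) zi.
have := nth_moves P (Ordinal iA); have := nth_moves P (Ordinal iA') => /= -> ->.
case: existsP => [[j /andP[/eqP jE /eqP Pj]]|_]; last by rewrite addn0; lia.
case: existsP => [_|Nex]; first by rewrite !addn1.
rewrite addn0 addn1 ltn_neqAle zi andbT; apply/eqP => zE; case: Nex.
exists j; have := PP (Ordinal iA) j => /=.
have -> : (B + i.+1 <= j + nth 0%N z i.+1)%N = false by lia.
have := cP j (Ordinal iA') (Ordinal iA) (leqnSn i); move: Pj => /=.
move: (P (Ordinal iA) j : nat) (P (Ordinal iA') j : nat) => x y yE xy xle.
by apply/andP; split; apply/eqP; lia.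
Qed.

Lemma eraseP (e : A.-tuple bool) P : sorted ltn (shift z e) -> P \in S' -> moves P = e ->
  erase e P \in S (shift z e) /\ restore e (erase e P) = P.
Proof.
move=> es; rewrite !inE => /and4P[/plane_partitionP[rP cP] /forallP zB /forall2P PP dP] eE.
have eP (i : 'I_A) : nth false e i = [exists j : 'I_B, ((j + nth 0%N z i).+1 == B + i)%N &&
       (P i j + nth 0%N z i == tau + i)%N] by rewrite -eE nth_moves.
have hP (i : 'I_A) (j : 'I_B) : horizontal e i j ->
    (j + nth 0%N z i).+1 = (B + i)%N /\ (P i j + nth 0%N z i = tau + i)%N.
  case/andP; rewrite eP => /existsP[j' /andP[/eqP j'E /eqP PE]] /eqP jE.
  by have <- : j' = j by apply: val_inj; rewrite /=; lia.
have ze : size z = size e by rewrite size_tuple.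
have sE : size (shift z e) = A by rewrite size_map size_zip size_tuple sz minnn.
have gap (i1 i2 : 'I_A) : (i1 <= i2)%N -> (nth 0%N z i1 + nth false e i1 + (i2 - i1) <=
     nth 0%N z i2 + nth false e i2)%N.
  move=> i12; rewrite -!nth_shift //; apply: strict_gap => //.
  by rewrite sE i12 ltn_ord.
split; last first.
  apply/matrixP => i j; rewrite !mxE; case: (boolP (horizontal e i j)) => // /hP[_ PE].
  apply: val_inj; rewrite /= -PE addnK inordK //.
have zeroP (i : 'I_A) (j : 'I_B) : (B + i <= j + nth 0%N z i)%N -> P i j = 0%N :> nat.
  by move=> H; have := PP i j; rewrite H => /eqP.
have bigP (i : 'I_A) (j : 'I_B) : (j + nth 0%N z i < B + i)%N ->
    (tau + i <= P i j + nth 0%N z i)%N.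
  by move=> H; have := PP i j; rewrite leqNgt H.
have hE (i : 'I_A) (j : 'I_B) : nth false e i -> (j + nth 0%N z i).+1 = (B + i)%N ->
   horizontal e i j by rewrite /horizontal => -> ->; rewrite eqxx.
apply/and5P; split.
- apply/plane_partitionP; split=> [i j1 j2 j12|j i1 i2 i12]; rewrite !mxE.
    case: (boolP (horizontal e i j2)) => // h2.
    case: (boolP (horizontal e i j1)) => [h1|_]; last exact: rP.
    have [jE _] := hP _ _ h1; rewrite zeroP //.
    have : (j1 : nat) != j2 by apply: contraNneq h2 => /val_inj <-.
    lia.
  case: (boolP (horizontal e i2 j)) => // h2.
  case: (boolP (horizontal e i1 j)) => [h1|_]; last exact: cP.
  have [jE _] := hP _ _ h1; rewrite zeroP //.
  have e1 : nth false e i1 by case/andP: h1.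
  have := gap _ _ i12; rewrite e1.
  case: (boolP (nth false e i2)) => e2; last by lia.
  have : (j + nth 0%N z i2).+1 <> (B + i2)%N by move=> E; rewrite hE in h2.
  lia.
- apply/forallP => i; rewrite nth_shift //; have := zB i.
  rewrite eP; case: existsP => [[j /andP[/eqP jE _]]|_]; lia.
- apply/forall2P => i j; rewrite nth_shift // mxE.
  have [le|lt] := leqP (B + i) (j + (nth 0%N z i + nth false e i)).
    case: ifP => // /negbT hN; rewrite zeroP //.
    case: (boolP (nth false e i)) le => e1; last by lia.
    have : (j + nth 0%N z i).+1 <> (B + i)%N by move=> E; rewrite hE in hN.
    lia.
  case: ifP => [h|_].
    by have [jE _] := hP _ _ h; case/andP: h lt => -> _; lia.
  have tE : (B + C - m = tau.+1)%N by rewrite /tau; lia.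
  rewrite tE; case: (boolP (nth false e i)) lt => e1 lt.
    by have := bigP i j; rewrite /=; lia.
  have := bigP i j; rewrite addn0 in lt *; move=> /(_ lt) ge.
  rewrite addSn ltn_neqAle ge andbT; apply: contraNneq e1 => PE.
  (* The entry in column j has the height reached, hence so has the next entry
     of row i, in column (B + i).-1 - nth 0 z i: row i would move. *)
  have j0B : ((B + i).-1 - nth 0%N z i < B)%N by have := le_nth i; lia.
  rewrite eP; apply/existsP; exists (Ordinal j0B).
  apply/andP; split; apply/eqP => /=; first lia.
  have := rP i j (Ordinal j0B) => /=; have := bigP i (Ordinal j0B) => /=.
  move: (P i (Ordinal j0B) : nat) (P i j : nat) PE {ge} => x y yE; lia.
- apply/implyP => km; case/andP: dP => /implyP/(_ km)/forall2P rk _.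
  apply/forall2P => i j; apply/implyP => /andP[/eqP i0 jk]; rewrite mxE.
  have PE : P i j = C :> nat by apply/eqP; apply: (implyP (rk i j)); rewrite i0 jk.
  case: ifP => [/hP[jE PE']|_]; last by rewrite PE.
  move: PE'; rewrite PE /tau; lia.
- apply/implyP => tm; case/andP: dP => _ /implyP/(_ tm)/forall2P lk.
  apply/forall2P => i j; apply/implyP => ij; rewrite mxE.
  have /= le := implyP (lk i j) ij.
  by case: ifP => // _ /=; apply: leq_trans le; rewrite leq_add2r.
Qed.

Lemma restoreP (e : A.-tuple bool) Q : sorted ltn (shift z e) -> Q \in S (shift z e) ->
  (restore e Q \in S' /\ moves (restore e Q) = e) /\ erase e (restore e Q) = Q.
Proof.
move=> es; rewrite !inE => /and5P[/plane_partitionP[rP cP] /forallP zB /forall2P PP rkP lkP].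
have ze : size z = size e by rewrite size_tuple.
have sE : size (shift z e) = A by rewrite size_map size_zip size_tuple sz minnn.
have gap (i1 i2 : 'I_A) : (i1 <= i2)%N -> (nth 0%N z i1 + nth false e i1 + (i2 - i1) <=
     nth 0%N z i2 + nth false e i2)%N.
  move=> i12; rewrite -!nth_shift //; apply: strict_gap => //.
  by rewrite sE i12 ltn_ord.
have gapz (i1 i2 : 'I_A) : (i1 <= i2)%N -> (nth 0%N z i1 + (i2 - i1) <= nth 0%N z i2)%N.
  by move=> i12; apply: strict_gap => //; rewrite sz i12 ltn_ord.
have tE : (B + C - m = tau.+1)%N by rewrite /tau; lia.
have zeroQ (i : 'I_A) (j : 'I_B) : (B + i <= j + (nth 0%N z i + nth false e i))%N ->
    Q i j = 0%N :> nat.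
  by move=> H; have := PP i j; rewrite nth_shift // H => /eqP.
have bigQ (i : 'I_A) (j : 'I_B) : (j + (nth 0%N z i + nth false e i) < B + i)%N ->
    (tau.+1 + i <= Q i j + (nth 0%N z i + nth false e i))%N.
  by move=> H; have := PP i j; rewrite nth_shift // leqNgt H tE.
have hP (i : 'I_A) (j : 'I_B) : horizontal e i j ->
    (j + nth 0%N z i).+1 = (B + i)%N /\ nth false e i by case/andP => -> /eqP.
have hE (i : 'I_A) (j : 'I_B) : nth false e i -> (j + nth 0%N z i).+1 = (B + i)%N ->
   horizontal e i j by rewrite /horizontal => -> ->; rewrite eqxx.
have vE (i : 'I_A) (j : 'I_B) : horizontal e i j ->
    (inord (tau + i - nth 0%N z i) : 'I_C.+1) = (tau + i - nth 0%N z i)%N :> nat.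
  move=> /hP[jE ei]; rewrite inordK // ltnS.
  (* The height reached is at most C: compare with the leftmost entry. *)
  have [j0|j0] := posnP j; first by move: jE; rewrite j0 /tau; lia.
  have B0 : (0 < B)%N by apply: leq_ltn_trans (ltn_ord j).
  have H : (Ordinal B0 + (nth 0%N z i + nth false e i) < B + i)%N by rewrite /= ei; lia.
  have := bigQ i (Ordinal B0) H; rewrite ei.
  have := leq_ord (Q i (Ordinal B0)).
  move: (nat_of_ord (Q i (Ordinal B0))) (nth 0%N z i) tau => x y u; lia.
have zt (i : 'I_A) : (nth 0%N z i <= tau + i)%N by apply: zle.
have QE (i : 'I_A) (j : 'I_B) : restore e Q i j =
    (if horizontal e i j then tau + i - nth 0%N z i else Q i j)%N :> nat.
  by rewrite mxE; case: ifP => // /vE.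
split; last first.
  apply/matrixP => i j; rewrite !mxE; case: (boolP (horizontal e i j)) => // /hP[jE ei].
  apply: val_inj; rewrite /= zeroQ // ei; lia.
split.
  apply/and4P; split.
  - apply/plane_partitionP; split=> [i j1 j2 j12|j i1 i2 i12]; rewrite !QE.
      case: (boolP (horizontal e i j2)) => h2; case: (boolP (horizontal e i j1)) => h1 //.
      + have [jE ei] := hP _ _ h2.
        have j1N : (j1 + nth 0%N z i).+1 <> (B + i)%N by move=> E; rewrite hE in h1.
        by have := bigQ i j1; rewrite ei; lia.
      + have [jE ei] := hP _ _ h1; rewrite zeroQ // ei; lia.
      + exact: rP.
    case: (boolP (horizontal e i2 j)) => h2; case: (boolP (horizontal e i1 j)) => h1.
    - by have [jE1 _] := hP _ _ h1; have [jE2 _] := hP _ _ h2; lia.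
    - have [jE2 e2] := hP _ _ h2; have := gap _ _ i12; have := gapz _ _ i12; rewrite e2.
      have := bigQ i1 j; case: (boolP (nth false e i1)) => e1; last by lia.
      have : (j + nth 0%N z i1).+1 <> (B + i1)%N by move=> E; rewrite hE in h1.
      lia.
    - have [jE e1] := hP _ _ h1; rewrite zeroQ //.
      by have := gap _ _ i12; rewrite e1; lia.
    exact: cP.
  - by apply/forallP => i; have := zB i; rewrite nth_shift //; lia.
  - apply/forall2P => i j; rewrite QE; have [le|lt] := leqP (B + i) (j + nth 0%N z i).
      case: (boolP (horizontal e i j)) => [/hP[jE _]|_]; first by lia.
      by rewrite zeroQ //; lia.
    case: (boolP (horizontal e i j)) => [/hP[jE _]|h]; first by have := zt i; lia.
    have := bigQ i j; case: (boolP (nth false e i)) => ei; last by lia.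
    have : (j + nth 0%N z i).+1 <> (B + i)%N by move=> E; rewrite hE in h.
    lia.
  apply/andP; split; apply/implyP => km.
    have /forall2P rk := implyP rkP km.
    apply/forall2P => i j; apply/implyP => ij; rewrite QE.
    have /eqP PE : Q i j == C :> nat by apply: (implyP (rk i j)).
    case: ifP => [/hP[jE ei]|_]; last by rewrite PE.
    have : Q i j = 0%N :> nat by apply: zeroQ; rewrite ei; lia.
    by rewrite PE => C0; move: C_gt0; rewrite C0.
  have /forall2P lk := implyP lkP km.
  apply/forall2P => i j; apply/implyP => ij; rewrite QE.
  case: ifP => [/hP[jE ei]|_]; last by apply: (implyP (lk i j)).
  by case/andP: ij => _ /eqP j0; move: jE (zt i); rewrite j0 /tau; lia.
apply: eq_from_tnth => i; rewrite !(tnth_nth false) nth_moves.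
case: (boolP (nth false e i)) => ei.
  have j0B : ((B + i).-1 - nth 0%N z i < B)%N.
    by have := le_nth i; have := zB i; rewrite nth_shift // ei; lia.
  apply/existsP; exists (Ordinal j0B).
  have jE : ((Ordinal j0B : nat) + nth 0%N z i).+1 = (B + i)%N.
    by rewrite /=; have := zB i; rewrite nth_shift // ei; lia.
  by rewrite jE eqxx QE hE //=; apply/eqP; have := zt i; lia.
apply/existsP => -[j /andP[/eqP jE]]; rewrite QE.
have -> : horizontal e i j = false by rewrite /horizontal (negbTE ei).
by move/eqP => QE'; have := bigQ i j; rewrite (negbTE ei); lia.
Qed.

(** Sorting by the next step: [erase] and [restore] are inverse bijections between
    the plane partitions with given next step e and those for the state reached
    by e. *)
Lemma card_step : #|S'|%:R = \sum_(e : A.-tuple bool)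
  (if sorted ltn (shift z e) then #|S (shift z e)| else 0)%N%:R :> rat.
Proof.
rewrite -natr_sum; congr (_%:R); rewrite -sum1_card (partition_big moves xpredT) //=.
apply: eq_bigr => e _; rewrite sum1dep_card; case: ifP => [es|/negbT eNs].
  apply: (@card_bij_on _ _ _ _ (erase e) (restore e)) => [P|Q QS].
    by rewrite inE => /andP[PS /eqP Pe]; apply: eraseP.
  have [[H1 /eqP H2] H3] := restoreP es QS; by rewrite inE H1 H2.
apply/eqP; rewrite cards_eq0; apply/eqP/setP => P; rewrite inE in_set0.
apply: contraNF eNs => /andP[PS /eqP <-]; exact: moves_strict.
Qed.

End Step.
(** After all but k steps the first row has made at least B - k horizontal steps.
    It has made exactly B - k if and only if all the vertical steps are over,
    that is, the k entries still to be read are C. *)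
Lemma run_barrier A B C k z (P : 'M['I_C.+1]_(A, B)) :
    (0 < C)%N -> (0 < k <= B)%N -> size z = A -> prefix_cond (B + C - k) z P ->
  run k P = (nth (B - k) z 0 == B - k)%N.
Proof.
move=> C0 /andP[k0 kB] sz /forall2P PP.
have [A0|A0] := posnP A.
  rewrite nth_default ?sz ?A0 // eqxx; apply/forall2P => i.
  by have := ltn_ord i; rewrite [X in (_ < X)%N]A0.
rewrite (set_nth_default 0%N) ?sz //.
pose i0 := Ordinal A0.
apply/forall2P/eqP => [rk|zE i j].
  have kB' : (k.-1 < B)%N by lia.
  have := PP i0 (Ordinal kB'); have /= := rk i0 (Ordinal kB').
  rewrite prednK // leqnn !addn0 => /eqP ->.
  by case: leqP; lia.
apply/implyP => /andP[/eqP i0' jk]; have := PP i j; have := leq_ord (P i j).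
have -> : (B + i <= j + nth 0%N z i)%N = false by rewrite i0' zE; lia.
rewrite i0' zE; move: (nat_of_ord (P i j)) => x; lia.
Qed.

(** With t steps left, the last row is completely read if and only if its
    leftmost entry is at most C - t: otherwise the height reached exceeds C - t. *)
Lemma low_barrier A B C t z (P : 'M['I_C.+1]_(A, B)) :
    (t <= C)%N -> sorted ltn z -> size z = A ->
    [forall i : 'I_A, nth 0%N z i <= B + i]%N -> prefix_cond (B + C - t) z P ->
  low t P = (last (B + A).-1 z == (B + A).-1).
Proof.
move=> tC zs sz /forallP zB /forall2P PP.
have [A0|A0] := posnP A.
  have z0 : z = [::] by apply/nilP; rewrite /nilp sz A0.
  rewrite z0 /= eqxx; apply/forall2P => i.
  by have := ltn_ord i; rewrite [X in (_ < X)%N]A0.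
rewrite -nth_last (set_nth_default 0%N) ?sz ?prednK //.
have A1 : (A.-1 < A)%N by rewrite prednK.
pose i1 := Ordinal A1.
have i1P (i : 'I_A) : i.+1 = A -> i = i1 by move=> iE; apply: val_inj => /=; lia.
have zge : (A.-1 <= nth 0%N z A.-1)%N.
  have := @strict_gap z 0 A.-1 zs; rewrite sz A1 subn0 => /(_ isT); lia.
have /= zle := zB i1.
apply/forall2P/eqP => [lk|zE i j].
  have [B0|B0] := posnP B; first by move: zle; rewrite B0; lia.
  have := PP i1 (Ordinal B0); have /= := lk i1 (Ordinal B0).
  rewrite prednK // !eqxx /= add0n.
  move: (nat_of_ord (P i1 (Ordinal B0))) => x xC; case: leqP; lia.
apply/implyP => /andP[/eqP iE /eqP j0]; have := PP i j.
rewrite (i1P _ iE) j0 /= zE; have -> : (B + A.-1 <= 0 + (B + A).-1)%N by lia.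
by move/eqP => ->.
Qed.

(** The states that occur are those that can be reached, whence the bound on the
    entries of z. *)
Theorem completionsE A B C k t m z : (0 < C)%N -> (k <= B)%N -> (t <= C)%N ->
    (m <= B + C)%N -> sorted ltn z -> size z = A ->
    (forall i, (i < A)%N -> (nth 0%N z i <= (B + C - m) + i)%N) ->
  completions A B k t m z = #|partials A B C k t m z|%:R.
Proof.
move=> C0 kB tC; elim: m z => [|m IHm] z mBC zs sz zle /=.
  have [->|zN] := eqVneq z (final_state A B).
    have zE (i : 'I_A) : nth 0%N (final_state A B) i = (B + i)%N.
      by rewrite (nth_map 0%N) ?size_iota // nth_iota.
    rewrite (_ : partials _ _ _ _ _ _ _ = [set const_mx ord0]) ?cards1 //.
    apply/setP => P; rewrite !inE; apply/and5P/eqP => [[_ _ /forall2P PP _ _]|->].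
      apply/matrixP => i j; rewrite mxE; apply: val_inj.
      by have := PP i j; rewrite zE leq_addl => /eqP.
    split.
    - by apply/plane_partitionP; split=> *; rewrite !mxE.
    - by apply/forallP => i; rewrite zE.
    - by apply/forall2P => i j; rewrite zE leq_addl mxE.
    - by rewrite leqn0; apply/implyP => /eqP->; apply/forall2P => i j; rewrite ltn0 andbF.
    by apply/implyP; rewrite leqn0 => /eqP->; apply/forall2P => i j; rewrite mxE implybT.
  rewrite (_ : partials _ _ _ _ _ _ _ = set0) ?cards0 //.
  apply/setP => P; rewrite !inE; apply/negP => /and5P[_ /forallP zB /forall2P PP _ _].
  case/eqP: zN; apply: (@eq_from_nth _ 0%N); rewrite ?size_map ?size_iota ?sz // => i iA.
  rewrite (nth_map 0%N) ?size_iota // nth_iota //; apply/eqP.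
  have /= zBi := zB (Ordinal iA).
  rewrite eqn_leq zBi leqNgt; apply/negP => lt.
  have zi : (i <= nth 0%N z i)%N.
    by have := @strict_gap z 0 i zs; rewrite sz iA subn0 => /(_ isT); lia.
  have B0 : (0 < B)%N by rewrite add0n in lt; lia.
  have := PP (Ordinal iA) (Ordinal B0); have := leq_ord (P (Ordinal iA) (Ordinal B0)).
  have -> : (B + Ordinal iA <= Ordinal B0 + nth 0%N z (Ordinal iA))%N = false.
    by rewrite /=; lia.
  move: (nat_of_ord (P _ _)) => x /=; lia.
have step := @card_step A B C k t m z C0 mBC zs sz zle.
rewrite zs /= (transfer_sum _ sz).
set S' := finset _ in step.
have -> : \sum_(e : A.-tuple bool) completions A B k t m (shift z e) = #|S'|%:R.
  rewrite step; apply: eq_bigr => e _; case: ifP => [es|/negbT/completions_strict->//].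
  apply: IHm => //; first exact: ltnW.
    by rewrite size_map size_zip size_tuple sz minnn.
  move=> i iA; rewrite nth_shift ?size_tuple //; have := zle i iA.
  by case: (nth false e i) => /=; lia.
have barE P : P \in S' -> (barrier A B k t m.+1 z) =
   ((m.+1 == k) ==> run k P) && ((m.+1 == t) ==> low t P).
  rewrite inE => /and4P[_ zB PP _]; rewrite /barrier; congr (_ && _).
    case: eqP => //= mk; rewrite (@run_barrier _ _ _ _ z) //; first by rewrite kB -mk.
    by rewrite -mk.
  by case: eqP => //= mt; rewrite (@low_barrier _ _ _ _ z) // -mt.
have -> : partials A B C k t m.+1 z = if barrier A B k t m.+1 z then S' else set0.
  apply/setP => P; have PE : (P \in partials A B C k t m.+1 z) = (P \in S') &&
      (((m.+1 == k) ==> run k P) && ((m.+1 == t) ==> low t P)).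
    rewrite !inE -!andbA; do 3!congr (_ && _).
    have leE l : (l <= m.+1)%N = (m.+1 == l) || (l <= m)%N by rewrite leq_eqVlt eq_sym ltnS.
    rewrite !leE; case: (m.+1 == k); case: (m.+1 == t); case: (k <= m)%N;
      by case: (t <= m)%N; case: (run k P); case: (low t P).
  rewrite PE; case: (boolP (P \in S')) => [PS|PN].
    by rewrite -(barE P PS); case: ifP; rewrite ?PS ?in_set0.
  by case: ifP; rewrite ?(negbTE PN) ?in_set0.
by case: ifP => // _; rewrite cards0.
Qed.

Lemma card_ord_ge A c : #|[set i : 'I_A | (c <= i)%N]| = (A - c)%N.
Proof.
rewrite -sum1dep_card.
rewrite -(big_mkord (fun i => c <= i)%N (fun=> 1%N)).
by rewrite -(@big_nat_widenl _ _ _ c 0 A xpredT) // sum_nat_const_nat muln1.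
Qed.

Lemma upclosed_mem A (S : {set 'I_A}) (i : 'I_A) :
    (forall i1 i2 : 'I_A, (i1 <= i2)%N -> i1 \in S -> i2 \in S) ->
  (i \in S) = (A - #|S| <= i)%N.
Proof.
move=> up; have [iS|iNS] := boolP (i \in S).
  have sub : [set l : 'I_A | (i <= l)%N] \subset S.
    by apply/subsetP => l; rewrite inE => /up; apply.
  have := subset_leq_card sub; rewrite card_ord_ge; move: #|S| => c; have := ltn_ord i; lia.
have sub : S \subset [set l : 'I_A | (i.+1 <= l)%N].
  apply/subsetP => l lS; rewrite inE ltnNge; apply: contra iNS => li.
  exact: up li lS.
have := subset_leq_card sub; rewrite card_ord_ge; have := ltn_ord i; lia.
Qed.

Definition zeros A B C (P : 'M['I_C.+1]_(A, B.+1)) : nat :=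
  #|[set i : 'I_A | P i ord_max == 0%N :> nat]|.

Lemma zerosP A B C (P : 'M['I_C.+1]_(A, B.+1)) (i : 'I_A) : plane_partition P ->
  (P i ord_max == 0%N :> nat) = (A - zeros P <= i)%N.
Proof.
move=> /plane_partitionP[_ cP].
rewrite -(@upclosed_mem _ [set i : 'I_A | P i ord_max == 0%N :> nat]) ?inE // => i1 i2 i12.
by rewrite !inE -!leqn0; apply: leq_trans; apply: cP.
Qed.

Lemma zeros_le A B C (P : 'M['I_C.+1]_(A, B.+1)) : (zeros P <= A)%N.
Proof. by rewrite -[X in (_ <= X)%N]card_ord max_card. Qed.

(** After one step the particles omit exactly one of the positions 0, ..., A.
    If it is j, the rows i >= j have moved, that is, they end with 0. *)
Lemma partials_start A B C k t j : (0 < C)%N -> (k <= B.+1)%N -> (t <= C)%N -> (j <= A)%N ->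
  partials A B.+1 C k t (B + C) (take j (iota 0 A.+1) ++ drop j.+1 (iota 0 A.+1)) =
  [set P | [&& plane_partition P, zeros P == A - j, run k P & low t P]%N].
Proof.
move=> C0 kB tC jA; apply/setP => P; rewrite !inE.
set z := (_ ++ _).
have zE (i : 'I_A) : nth 0%N z i = (i + (j <= i))%N.
  have := ltn_ord i => iA.
  rewrite nth_take_drop size_iota ltnS jA andbT.
  by case: ltnP => ij; rewrite nth_iota ?add0n ?addn0 ?addn1 //; lia.
have -> : (k <= B + C)%N by lia.
have -> : (t <= B + C)%N by lia.
have -> : (B.+1 + C - (B + C) = 1)%N by lia.
rewrite /=; case: (boolP (plane_partition P)) => //= Ppp.
have -> : [forall i : 'I_A, nth 0%N z i <= B.+1 + i]%N.
  by apply/forallP => i; rewrite zE; case: leqP; lia.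
rewrite andTb; congr (_ && _); have := Ppp => /plane_partitionP[rP _].
rewrite /prefix_cond; apply/forall2P/eqP => [PP|zeroE i l].
  have H (i : 'I_A) : (P i ord_max == 0%N :> nat) = (j <= i)%N.
    have := PP i ord_max; rewrite zE /=; case: (leqP j i) => ji /=.
      by rewrite addn1 addSnnS leqnn => ->.
    by rewrite addn0 leqNgt ltnS leqnn /= => P0; apply/eqP; lia.
  by rewrite /zeros; under eq_finset do rewrite H; rewrite card_ord_ge.
have H := zerosP i Ppp; rewrite zeroE subKn // in H.
have lB := ltn_ord l; have := rP i l ord_max; rewrite -ltnS lB => /(_ isT).
rewrite zE; case: (leqP j i) H => ji /eqP H Hl /=.
  have [le|lt] := leqP (B.+1 + i) (l + (i + 1)); last by lia.
  have -> : l = ord_max by apply: val_inj => /=; lia.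
  by rewrite H.
have -> : (B.+1 + i <= l + (i + 0))%N = false by lia.
lia.
Qed.

(** [wedge_completions] one step after the start. *)
Theorem zeros_kernel_cumulative A B C k t i : (0 < C)%N -> (k <= B.+1)%N -> (t <= C)%N ->
    (i < A)%N -> (i = 0%N -> k = 0%N) -> (i.+1 = A -> t = 0%N) ->
  \sum_(j < A.+1) (-1) ^+ j * (reaches (B + C) j (B.+1 + i))%:R *
    #|[set P : 'M['I_C.+1]_(A, B.+1) |
        [&& plane_partition P, zeros P == A - j, run k P & low t P]%N]|%:R = 0 :> rat.
Proof.
move=> C0 kB tC iA ik it.
have := @wedge_completions A B.+1 k t i (B + C) (iota 0 A.+1) iA kB ik it
  (iota_ltn_sorted _ _) (size_iota _ _).
rewrite wedge_sum size_iota => sum0; rewrite -[RHS]sum0.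
apply: eq_bigr => j _; have jA : (j <= A)%N by rewrite -ltnS.
rewrite nth_iota ?add0n // -partials_start // -completionsE //.
- exact: (subseq_sorted ltn_trans (subseq_take_drop _ _) (iota_ltn_sorted 0 A.+1)).
- by rewrite size_take_drop size_iota.
move=> l lA; rewrite nth_take_drop size_iota ltn_ord andbT.
by case: ifP => _; rewrite nth_iota; lia.
Qed.
(** * Linear relations between the refined counts *)

Definition tops A B C (P : 'M['I_C.+1]_(A.+1, B)) : nat :=
  #|[set j : 'I_B | P ord0 j == C :> nat]|.

Lemma downclosed_mem B (S : {set 'I_B}) (i : 'I_B) :
    (forall i1 i2 : 'I_B, (i1 <= i2)%N -> i2 \in S -> i1 \in S) ->
  (i \in S) = (i < #|S|)%N.
Proof.
move=> down; have := @upclosed_mem _ (~: S) i; rewrite inE => H.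
have cS := cardsCs S.
have leS : (#|~: S| <= B)%N by rewrite -[X in (_ <= X)%N]card_ord max_card.
rewrite card_ord in cS.
apply: negb_inj; rewrite H; first by rewrite -leqNgt cS.
by move=> i1 i2 i12; rewrite !inE; apply: contra; apply: down.
Qed.

Lemma topsP A B C (P : 'M['I_C.+1]_(A.+1, B)) (j : 'I_B) : plane_partition P ->
  (P ord0 j == C :> nat) = (j < tops P)%N.
Proof.
move=> /plane_partitionP[rP _].
rewrite -(@downclosed_mem _ [set j : 'I_B | P ord0 j == C :> nat]) ?inE // => j1 j2 j12.
rewrite !inE => /eqP PE; rewrite eqn_leq leq_ord /=; by have := rP ord0 _ _ j12; rewrite PE.
Qed.

Lemma run_tops A B C k (P : 'M['I_C.+1]_(A.+1, B)) : plane_partition P -> (k <= B)%N ->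
  run k P = (k <= tops P)%N.
Proof.
move=> Ppp kB; apply/forall2P/idP => [rk|kt i j].
  case: k kB rk => // k kB rk.
  by have := rk ord0 (Ordinal kB); rewrite eqxx ltnS leqnn /= topsP.
apply/implyP => /andP[/eqP i0 jk].
have -> : i = ord0 by apply: val_inj.
by rewrite topsP // (leq_trans jk).
Qed.

Lemma low_corner A B C t (P : 'M['I_C.+1]_(A.+1, B.+1)) :
  low t P = (P ord_max ord0 + t <= C)%N.
Proof.
apply/forall2P/idP => [/(_ ord_max ord0)|le i j]; first by rewrite !eqxx.
apply/implyP => /andP[/eqP[iA] /eqP j0].
have -> : i = ord_max by apply: val_inj.
by have -> : j = ord0 by apply: val_inj.
Qed.

Lemma card_exact (T : finType) (f : T -> nat) (Q : pred T) k :
  #|[set x | Q x & f x == k]|%:R =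
  #|[set x | Q x & (k <= f x)%N]|%:R - #|[set x | Q x & (k.+1 <= f x)%N]|%:R :> rat.
Proof.
apply/eqP; rewrite -subr_eq opprK -natrD; apply/eqP; congr (_%:R).
rewrite -cardsUI [X in (_ + X)%N](_ : _ = 0%N).
  by rewrite addn0; apply: eq_card => x; rewrite !inE -andb_orr [f x == k]eq_sym -leq_eqVlt.
apply: eq_card0 => x; rewrite !inE; case: (Q x) => //=.
by case: eqP => //= ->; rewrite ltnn.
Qed.

Lemma zeros_kernel A B C i : (0 < C)%N -> (i < A)%N ->
  \sum_(j < A.+1) (-1) ^+ j * (reaches (B + C) j (B.+1 + i))%:R *
    #|[set P : 'M['I_C.+1]_(A, B.+1) | plane_partition P & zeros P == A - j]%N|%:R
  = 0 :> rat.
Proof.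
move=> C0 iA; rewrite -[RHS](@zeros_kernel_cumulative A B C 0 0 i) //.
apply: eq_bigr => j _; congr (_ * _%:R); apply: eq_card => P; rewrite !inE.
have -> : run 0 P by apply/forall2P => l m; rewrite ltn0 andbF.
have -> : low 0 P by apply/forall2P => l m; rewrite addn0 leq_ord implybT.
by rewrite !andbT.
Qed.

(** The relations hold for the plane partitions with at least k entries C in the
    first row, hence for the difference of two such classes. *)
Lemma zeros_tops_kernel A B C k i : (0 < C)%N -> (0 < i < A.+1)%N ->
  \sum_(j < A.+2) (-1) ^+ j * (reaches (B + C) j (B.+1 + i))%:R *
    #|[set P : 'M['I_C.+1]_(A.+1, B.+1) |
      [&& plane_partition P, zeros P == A.+1 - j & tops P == k]%N]|%:R = 0 :> rat.
Proof.
move=> C0 /andP[i0 iA].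
have ge0 l : \sum_(j < A.+2) (-1) ^+ j * (reaches (B + C) j (B.+1 + i))%:R *
    #|[set P : 'M['I_C.+1]_(A.+1, B.+1) |
      (plane_partition P && (zeros P == A.+1 - j)%N) & (l <= tops P)%N]|%:R = 0 :> rat.
  have [lB|Bl] := leqP l B.+1; last first.
    rewrite big1 // => j _; rewrite eq_card0 ?mulr0 // => P; rewrite !inE (leqNgt l).
    by rewrite (leq_ltn_trans _ Bl) ?andbF // -[X in (_ <= X)%N]card_ord max_card.
  rewrite -[RHS](@zeros_kernel_cumulative A.+1 B C l 0 i) //; last by move: i0; case: (i).
  apply: eq_bigr => j _; congr (_ * _%:R); apply: eq_card => P; rewrite !inE.
  case: (boolP (plane_partition P)) => //= Ppp; rewrite run_tops // low_corner addn0 leq_ord.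
  by rewrite andbT.
have := congr2 (fun x y => x - y) (ge0 k) (ge0 k.+1); rewrite /= subrr => E0; rewrite -[RHS]E0.
rewrite -sumrB; apply: eq_bigr => j _.
rewrite -mulrBr -card_exact; congr (_ * _%:R).
by apply: eq_card => P; rewrite !inE andbA.
Qed.

(** As above, with a second difference for the bottom-left entry. *)
Lemma zeros_tops_corner_kernel A B C k h i : (0 < C)%N -> (0 < i < A)%N -> (h <= C)%N ->
  \sum_(j < A.+2) (-1) ^+ j * (reaches (B + C) j (B.+1 + i))%:R *
    #|[set P : 'M['I_C.+1]_(A.+1, B.+1) |
      [&& plane_partition P, zeros P == A.+1 - j, tops P == k
        & P ord_max ord0 == h :> nat]%N]|%:R = 0 :> rat.
Proof.
move=> C0 /andP[i0 iA] hC.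
pose Z (j : nat) (P : 'M['I_C.+1]_(A.+1, B.+1)) :=
  plane_partition P && (zeros P == A.+1 - j)%N.
pose w (j : nat) : rat := (-1) ^+ j * (reaches (B + C) j (B.+1 + i))%:R.
have ge0 l t : \sum_(j < A.+2) w j *
    #|[set P | (Z j P && (l <= tops P)%N) & (t <= C - P ord_max ord0)%N]|%:R = 0 :> rat.
  have [lB|Bl] := leqP l B.+1; last first.
    rewrite big1 // => j _; rewrite eq_card0 ?mulr0 // => P; rewrite !inE (leqNgt l).
    by rewrite (leq_ltn_trans _ Bl) ?andbF // -[X in (_ <= X)%N]card_ord max_card.
  have [tC|Ct] := leqP t C; last first.
    rewrite big1 // => j _; rewrite eq_card0 ?mulr0 // => P; rewrite !inE (leqNgt t).
    by rewrite (leq_ltn_trans _ Ct) ?andbF // leq_subr.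
  rewrite -[RHS](@zeros_kernel_cumulative A.+1 B C l t i) //; first last.
  - by move=> [iE]; rewrite iE ltnn in iA.
  - by move: i0; case: (i).
  - exact: ltnW.
  apply: eq_bigr => j _; congr (_ * _%:R); apply: eq_card => P; rewrite !inE /Z.
  case: (boolP (plane_partition P)) => //= Ppp; rewrite run_tops // low_corner.
  by rewrite leq_subRL ?leq_ord // andbA.
have ex0 k' : \sum_(j < A.+2) w j *
    #|[set P | (Z j P && (k' <= tops P)%N) & (C - P ord_max ord0 == C - h)%N]|%:R = 0 :> rat.
  have := congr2 (fun x y => x - y) (ge0 k' (C - h)%N) (ge0 k' (C - h).+1).
  rewrite /= subrr => E0; rewrite -[RHS]E0; rewrite -sumrB.
  by apply: eq_bigr => j _; rewrite -mulrBr -card_exact.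
have := congr2 (fun x y => x - y) (ex0 k) (ex0 k.+1); rewrite /= subrr => E0; rewrite -[RHS]E0.
rewrite -sumrB; apply: eq_bigr => j _.
have swap k' : #|[set P | (Z j P && (k' <= tops P)%N) & (C - P ord_max ord0 == C - h)%N]| =
   #|[set P | (Z j P && (C - P ord_max ord0 == C - h)%N) & (k' <= tops P)%N]|.
  by apply: eq_card => P; rewrite !inE andbAC.
rewrite -mulrBr !swap -card_exact; congr (_ * _%:R).
apply: eq_card => P; rewrite !inE /Z /=.
case: (plane_partition P) => //=; case: (zeros P == _) => //=; rewrite andbC; congr (_ && _).
have := leq_ord (P ord_max ord0); move: (nat_of_ord (P ord_max ord0)) => x xC.
apply/eqP/eqP; lia.
Qed.

(** * Rotating the box *)

(** The cyclic permutation (i, j, k) -> (j, k, i) of the cells of the box, a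
    plane partition being the set of the cells with k < P i j. *)
Definition rotate A B C (P : 'M['I_C.+1]_(A, B)) : 'M['I_A.+1]_(B, C) :=
  \matrix_(j, k) inord #|[set i : 'I_A | (k < P i j)%N]|.

Lemma rotate_lt A B C (P : 'M['I_C.+1]_(A, B)) (i : 'I_A) (j : 'I_B) (k : 'I_C) :
  plane_partition P -> (i < rotate P j k)%N = (k < P i j)%N.
Proof.
move=> /plane_partitionP[_ cP]; rewrite mxE inordK; last first.
  by rewrite ltnS -[X in (_ <= X)%N]card_ord max_card.
rewrite -(@downclosed_mem _ [set i : 'I_A | (k < P i j)%N]) ?inE // => i1 i2 i12.
by rewrite !inE => H; apply: leq_trans H _; apply: cP.
Qed.

(** Both sides are at most n, so it suffices to compare with the i < n. *)
Lemma leq_ords n (x y : 'I_n.+1) : (forall i : 'I_n, (i < x)%N -> (i < y)%N) -> (x <= y)%N.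
Proof.
move=> H; rewrite leqNgt; apply/negP => yx.
have yn : (y < n)%N by apply: leq_trans yx (leq_ord x).
by have := H (Ordinal yn) yx; rewrite /= ltnn.
Qed.

Lemma rotate_pp A B C (P : 'M['I_C.+1]_(A, B)) :
  plane_partition P -> plane_partition (rotate P).
Proof.
move=> Ppp; have /plane_partitionP[rP cP] := Ppp.
apply/plane_partitionP; split=> [j k1 k2 k12|k j1 j2 j12]; apply: leq_ords => i.
  by rewrite !rotate_lt //; apply: leq_ltn_trans.
by rewrite !rotate_lt // => H; apply: leq_trans H _; apply: rP.
Qed.

Lemma rotateK A B C (P : 'M['I_C.+1]_(A, B)) :
  plane_partition P -> rotate (rotate (rotate P)) = P.
Proof.
move=> Ppp; have P1 := rotate_pp Ppp; have P2 := rotate_pp P1.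
apply/matrixP => i j; apply: val_inj; apply/eqP; rewrite eqn_leq.
by apply/andP; split; apply: leq_ords => k; rewrite !rotate_lt.
Qed.

Lemma card_rotate A B C (Q : pred 'M['I_C.+1]_(A, B)) (Q' : pred 'M['I_A.+1]_(B, C)) :
    (forall P, plane_partition P -> Q' (rotate P) = Q P) ->
  #|[set P | plane_partition P & Q P]| = #|[set P | plane_partition P & Q' P]|.
Proof.
move=> QE; apply: (@card_bij_on _ _ _ _ (@rotate A B C) (fun P => rotate (rotate P))).
  by move=> P; rewrite !inE => /andP[Ppp QP]; rewrite rotate_pp // QE // rotateK.
move=> P; rewrite !inE => /andP[Ppp QP]; rewrite rotateK //; split=> //.
by rewrite !rotate_pp //= -QE ?rotate_pp // rotateK.
Qed.

(** The cells (0, j, C) of the edge seen by [tops] become the cells (j, C, 0),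
    seen by [zeros]. *)
Lemma zeros_rotate A B C (P : 'M['I_C.+2]_(A.+1, B)) : plane_partition P ->
  zeros (rotate P) = (B - tops P)%N.
Proof.
move=> Ppp; rewrite /zeros.
have -> : [set j : 'I_B | rotate P j ord_max == 0%N :> nat] =
    ~: [set j : 'I_B | P ord0 j == C.+1 :> nat].
  apply/setP => j; rewrite !inE -leqn0 leqNgt.
  have -> : (0 < rotate P j ord_max)%N = ((ord0 : 'I_A.+1) < rotate P j ord_max)%N by [].
  rewrite rotate_lt //= eqn_leq leq_ord /=; by [].
by rewrite cardsCs setCK card_ord.
Qed.

(** The cells (A, 0, k) of the edge below the bottom-left entry become the cells
    (0, k, A), seen by [tops]. *)
Lemma tops_rotate A B C (P : 'M['I_C.+1]_(A.+1, B.+1)) : plane_partition P ->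
  tops (rotate P) = P ord_max ord0.
Proof.
move=> Ppp; rewrite /tops.
have -> : [set k : 'I_C | rotate P ord0 k == A.+1 :> nat] =
   [set k : 'I_C | (k < P ord_max ord0)%N].
  by apply/setP => k; rewrite !inE eqn_leq leq_ord /= -rotate_lt.
apply/eqP; rewrite -(eqn_add2r #|~: [set k : 'I_C | (k < P ord_max ord0)%N]|) cardsC card_ord.
have -> : ~: [set k : 'I_C | (k < P ord_max ord0)%N] =
   [set k : 'I_C | (P ord_max ord0 <= k)%N].
  by apply/setP => k; rewrite !inE -leqNgt.
by rewrite card_ord_ge addnC subnK // leq_ord.
Qed.

(** * Removing a layer of the box *)

Definition raise A B C (P : 'M['I_C.+1]_(A, B)) : 'M['I_C.+2]_(A, B) :=
  \matrix_(i, j) lift ord0 (P i j).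

Definition lower A B C (P : 'M['I_C.+2]_(A, B)) : 'M['I_C.+1]_(A, B) :=
  \matrix_(i, j) inord (P i j).-1.

(** If the last column has no zero, no entry is 0 and all can be lowered by 1. *)
Lemma card_no_zeros A B C (Q : pred 'M['I_C.+2]_(A, B.+1)) :
  #|[set P | [&& plane_partition P, zeros P == 0%N & Q P]]| =
  #|[set P : 'M['I_C.+1]_(A, B.+1) | plane_partition P & Q (raise P)]|.
Proof.
have raiseE (P : 'M['I_C.+1]_(A, B.+1)) i j : raise P i j = (P i j).+1 :> nat by rewrite mxE.
have lowerE (P : 'M['I_C.+2]_(A, B.+1)) i j : lower P i j = (P i j).-1 :> nat.
  rewrite mxE inordK // ; have := leq_ord (P i j); lia.
apply: (@card_bij_on _ _ _ _ (@lower A B.+1 C) (@raise A B.+1 C)) => P; rewrite !inE.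
  move=> /and3P[Ppp z0 QP]; have /plane_partitionP[rP cP] := Ppp.
  have pos i j : (0 < P i j)%N.
    apply: leq_trans (rP i j ord_max (leq_ord j)); rewrite lt0n zerosP // (eqP z0) subn0.
    by rewrite -ltnNge.
  have K : raise (lower P) = P.
    by apply/matrixP => i j; apply: val_inj; rewrite /= raiseE lowerE prednK.
  rewrite K QP andbT; split=> //; apply/plane_partitionP; split=> *; rewrite !lowerE.
    by rewrite -!subn1 leq_sub2r // rP.
  by rewrite -!subn1 leq_sub2r // cP.
move=> /andP[Ppp QP]; have /plane_partitionP[rP cP] := Ppp.
have Rpp : plane_partition (raise P).
  apply/plane_partitionP; split=> *; rewrite !raiseE ltnS; [exact: rP|exact: cP].
split; last by apply/matrixP => i j; apply: val_inj; rewrite /= lowerE raiseE.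
rewrite Rpp QP andbT /= cards_eq0; apply/eqP/setP => i; by rewrite !inE raiseE.
Qed.

Definition add_column A B C (P : 'M['I_C.+1]_(A, B)) : 'M['I_C.+1]_(A, B.+1) :=
  \matrix_(i, j) if unlift ord_max j is Some j' then P i j' else ord0.

Definition drop_column A B C (P : 'M['I_C.+1]_(A, B.+1)) : 'M['I_C.+1]_(A, B) :=
  \matrix_(i, j) P i (lift ord_max j).

(** A last column of zeros carries no information. *)
Lemma card_all_zeros A B C (Q : pred 'M['I_C.+1]_(A, B.+1)) :
  #|[set P | [&& plane_partition P, zeros P == A & Q P]]| =
  #|[set P : 'M['I_C.+1]_(A, B) | plane_partition P & Q (add_column P)]|.
Proof.
apply: (@card_bij_on _ _ _ _ (@drop_column A B C) (@add_column A B C)) => P; rewrite !inE.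
  move=> /and3P[Ppp zA QP]; have /plane_partitionP[rP cP] := Ppp.
  have K : add_column (drop_column P) = P.
    apply/matrixP => i j; rewrite mxE; case: unliftP => [j' ->|->]; first by rewrite mxE.
    by apply: val_inj; apply/esym/eqP; rewrite /= zerosP // (eqP zA) subnn.
  rewrite K QP andbT; split=> //; apply/plane_partitionP; split=> *; rewrite !mxE.
    by apply: rP; rewrite !lift_max.
  exact: cP.
move=> /andP[Ppp QP]; have /plane_partitionP[rP cP] := Ppp.
split; last by apply/matrixP => i j; rewrite !mxE liftK.
rewrite QP andbT; apply/andP; split; last first.
  rewrite /zeros; apply/eqP; rewrite -[RHS]card_ord; apply: eq_card => i.
  by rewrite !inE mxE unlift_none.
apply/plane_partitionP; split=> [i j1 j2|j i1 i2 i12]; rewrite !mxE.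
  case: unliftP => [j2' ->|-> //]; case: unliftP => [j1' ->|->].
    by rewrite !lift_max; apply: rP.
  by rewrite lift_max /= leqNgt ltn_ord.
by case: unliftP => // j' _; apply: cP.
Qed.

Lemma tops_raise A B C (P : 'M['I_C.+1]_(A.+1, B)) : tops (raise P) = tops P.
Proof. by apply: eq_card => j; rewrite !inE mxE lift0. Qed.

Lemma tops_add_column A B C (P : 'M['I_C.+2]_(A.+1, B)) : tops (add_column P) = tops P.
Proof.
rewrite /tops -[RHS](card_imset _ (@lift_inj _ ord_max)); apply: eq_card => j; rewrite !inE mxE.
apply/idP/imsetP => [|[j' + ->]]; last by rewrite inE liftK.
by case: unliftP => [j' ->|->] // PE; exists j'; rewrite ?inE.
Qed.

Lemma corner_add_column A B C (P : 'M['I_C.+1]_(A.+1, B.+1)) :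
  add_column P ord_max ord0 = P ord_max ord0.
Proof.
rewrite mxE; case: unliftP => [j /(congr1 val)|/(congr1 val)] //=.
by rewrite /bump leqNgt ltn_ord /= => j0; congr (P _ _); apply: val_inj.
Qed.
(** * The closed formulas and their boundary values *)

Definition superfact (n : nat) : rat := \prod_(0 <= k < n) (k`!)%:R.

Lemma superfactS n : superfact n.+1 = superfact n * (n`!)%:R.
Proof. by rewrite /superfact big_nat_recr. Qed.

Lemma superfact_neq0 n : superfact n != 0.
Proof.
elim: n => [|n IHn]; first by rewrite /superfact big_geq ?oner_eq0.
by rewrite superfactS mulf_neq0 ?factr_neq0.
Qed.

(** MacMahon's formula for the A x B x C box. *)
Definition box_formula A B C : rat :=
  superfact A * superfact B * superfact C * superfact (A + B + C) /
  (superfact (A + B) * superfact (B + C) * superfact (A + C)).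

(** For the A x (B + 1) x (C + 1) box with r zeros in the last column. *)
Definition one_tile_formula A B C r : rat := rising r B * rising (A - r) C *
  (superfact A.+1 * superfact B * superfact C * superfact (A + B + C).+1 /
  (superfact (A + B).+1 * superfact (B + C).+1 * superfact (A + C).+1)).

(** For the (A + 1) x (B + 1) x (C + 2) box with r zeros in the last column and
    B + 1 - s entries equal to C + 2 in the first row. *)
Definition two_tile_formula A B C r s : rat :=
  rising r B * rising (A.+1 - r) C * rising s C * rising (B.+1 - s) A *
  (superfact A.+1 * superfact B.+1 * superfact C * superfact (A + B + C).+2 /
  (superfact (A + B).+2 * superfact (B + C).+2 * superfact (A + C).+2)) *
  (B.+1%:R * (A.+1 - r)%N%:R + r%:R * s%:R).

(** The factor of the final formula that is not a product of factorials; r', s'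
    and t' stand for a + 2 - r, b + 2 - s and c + 2 - t. *)
Definition factor3 (a b c r s t r' s' t' : rat) : rat :=
  (a + 1) * (b + 1) * (c + 1) * (r' * s' * t') + (a + 1) * (b + 1) * (c + 1) * (r * s * t)
  - r' * s' * t' * (r * s * t) + (a + 1) * (c + 1) * s' * t' * (r * s)
  + (b + 1) * (a + 1) * t' * r' * (s * t) + (c + 1) * (b + 1) * r' * s' * (t * r).

(** For the (a + 2) x (b + 2) x (c + 2) box with all three conditions. *)
Definition three_tile_formula a b c r s t : rat :=
  rising r b * rising (a.+2 - r) c * rising s c * rising (b.+2 - s) a *
  rising t a * rising (c.+2 - t) b *
  (superfact a.+1 * superfact b.+1 * superfact c.+1 * superfact (a + b + c).+3 /
  (superfact (a + b).+3 * superfact (b + c).+3 * superfact (a + c).+3)) *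
  factor3 a%:R b%:R c%:R r%:R s%:R t%:R
    (a.+2 - r)%N%:R (b.+2 - s)%N%:R (c.+2 - t)%N%:R.

Ltac neq0 :=
  rewrite ?factr_neq0 ?superfact_neq0 -?natrD ?nat1r ?natr1 ?pnatr_eq0 ?addn_eq0 ?andbF //=.

Lemma rising0n n : rising 0 n = n`!%:R.
Proof. by rewrite /rising fact0 divr1. Qed.

Lemma one_tile_formula_0 A B C : one_tile_formula A B C 0 = box_formula A B.+1 C.
Proof.
rewrite /one_tile_formula /box_formula subn0 rising0n /rising ?addnS ?addSn !superfactS.
by field; neq0.
Qed.

Lemma one_tile_formula_top A B C : one_tile_formula A B C A = box_formula A B C.+1.
Proof.
rewrite /one_tile_formula /box_formula subnn rising0n /rising ?addnS ?addSn !superfactS.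
by field; neq0.
Qed.

Lemma two_tile_formula_0 A B C s : (s <= B.+1)%N -> 
  two_tile_formula A B C 0 s = one_tile_formula B.+1 C A s.
Proof.
move=> sB; rewrite /two_tile_formula /one_tile_formula !subn0 rising0n /rising.
rewrite ?addnS ?addSn [(B + C + A)%N]addnC [(B + A)%N]addnC [(C + A)%N]addnC addnA.
rewrite !superfactS !factS !natrM.
by field; neq0.
Qed.

Lemma two_tile_formula_top A B C s : (s <= B)%N -> 
  two_tile_formula A B C A.+1 s.+1 = one_tile_formula B C.+1 A s.
Proof.
move=> sB; rewrite /two_tile_formula /one_tile_formula subnn subSS rising0n /rising mulr0 add0r.
rewrite ?addnS ?addSn [(B + C + A)%N]addnC [(B + A)%N]addnC [(C + A)%N]addnC addnA.
rewrite !superfactS !factS !natrM.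
by field; neq0.
Qed.

Lemma two_tile_formula_top0 A B C : two_tile_formula A B C A.+1 0 = 0.
Proof. by rewrite /two_tile_formula subnn; ring. Qed.

Lemma three_tile_formula_0 a b c s t : (s <= b.+2)%N -> (t <= c.+1)%N ->
  three_tile_formula a b c 0 s t = two_tile_formula b.+1 c a s t.
Proof.
move=> sb tc; rewrite /three_tile_formula /two_tile_formula !subn0 (subSn tc).
rewrite rising0n /rising /factor3.
rewrite ?addnS ?addSn [(b + c + a)%N]addnC [(b + a)%N]addnC [(c + a)%N]addnC addnA.
rewrite !superfactS !factS !natrM.
by field; neq0.
Qed.

Lemma three_tile_formula_0top a b c s : three_tile_formula a b c 0 s c.+2 = 0.
Proof. by rewrite /three_tile_formula subnn /factor3; ring. Qed.

Lemma three_tile_formula_top a b c s t : (s <= b.+1)%N -> (t <= c.+2)%N ->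
  three_tile_formula a b c a.+2 s.+1 t = two_tile_formula b c.+1 a s t.
Proof.
move=> sb tc; rewrite /three_tile_formula /two_tile_formula subnn subSS.
rewrite rising0n /rising /factor3.
rewrite (natrB _ sb) (natrB _ tc).
rewrite ?addnS ?addSn [(b + c + a)%N]addnC [(b + a)%N]addnC [(c + a)%N]addnC addnA.
rewrite !superfactS !factS !natrM.
by field; neq0.
Qed.

Lemma three_tile_formula_top0 a b c t : three_tile_formula a b c a.+2 0 t = 0.
Proof. by rewrite /three_tile_formula subnn /factor3; ring. Qed.
(** The Chu-Vandermonde identity with upper indices running; both sides satisfy
    Pascal's rule in K and p. *)
Lemma sum_bin_shift K p q :
  (\sum_(j < K.+1) 'C(K - j + p, p) * 'C(j + q, q) = 'C((K + p + q).+1, K))%N.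
Proof.
elim: p K => [|p IHp] K.
  under eq_bigr do rewrite bin0 mul1n.
  elim: K => [|K IHK]; first by rewrite big_ord_recr big_ord0 /= binn bin0.
  rewrite big_ord_recr /= IHK !addn0 !addSn binS addnC; congr (_ + _)%N.
  by rewrite -addSn -[RHS]bin_sub ?leq_addr // addKn.
elim: K => [|K IHK]; first by rewrite big_ord_recr big_ord0 /= !add0n !binn bin0.
have -> : ('C((K.+1 + p.+1 + q).+1, K.+1) =
    'C((K + p.+1 + q).+1, K) + 'C((K.+1 + p + q).+1, K.+1))%N.
  by rewrite !addSn binS addnC addnS addSn.
rewrite -IHK -IHp.
rewrite big_ord_recr [X in (_ = _ + X)%N]big_ord_recr /= !subnn !add0n !binn.
rewrite [RHS]addnA -big_split /=; congr (_ + _)%N; apply: eq_bigr => j _.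
have jK : (j <= K)%N by rewrite -ltnS.
by rewrite subSn // addSn addnS binS mulnDl addSn.
Qed.

Lemma risingE m k : rising m k = k`!%:R * 'C(m + k, k)%:R.
Proof.
have mk : (k <= m + k)%N by rewrite leq_addl.
by rewrite /rising -(bin_fact mk) addnK !natrM; field; neq0.
Qed.

Lemma risingS m k : rising m k.+1 = (m + k.+1)%:R * rising m k.
Proof. by rewrite /rising addnS factS natrM mulrA. Qed.

Lemma sum_rising K p q :
  \sum_(j < K.+1) rising (K - j) p * rising j q =
  p`!%:R * q`!%:R * ((K + p + q).+1)`!%:R / (K`!%:R * ((p + q).+1)`!%:R).
Proof.
under eq_bigr do rewrite !risingE mulrACA -[X in _ * X]natrM.
rewrite -mulr_sumr -natr_sum sum_bin_shift -[RHS]mulrA; congr (_ * _).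
have Kn : (K <= (K + p + q).+1)%N by lia.
rewrite -(bin_fact Kn) (_ : (K + p + q).+1 - K = (p + q).+1)%N; last by lia.
by rewrite !natrM; field; neq0.
Qed.

(** Here r = a + 2 - j.  Up to a factor independent of j, the summand is
    rising r b * rising j c times al * j + be * r + ga * r * j, and the sum of
    each of the three terms follows from [sum_rising]. *)
Lemma sum_three_tile_formula a b c s t : (s <= b.+2)%N -> (t <= c.+2)%N ->
  \sum_(j < a.+3) three_tile_formula a b c (a.+2 - j) s t = two_tile_formula b.+1 c.+1 a s t.
Proof.
move=> sb tc; pose K := a.+2.
pose S p q := \sum_(j < K.+1) rising (K - j) p * rising j q.
pose s' := (b.+2 - s)%N; pose t' := (c.+2 - t)%N.
pose al : rat := (a%:R + 1) * (b%:R + 1) * (c%:R + 1) * s'%:R * t'%:R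
  + (b%:R + 1) * (a%:R + 1) * t'%:R * s%:R * t%:R.
pose be : rat := (a%:R + 1) * (b%:R + 1) * (c%:R + 1) * s%:R * t%:R
  + (a%:R + 1) * (c%:R + 1) * s'%:R * t'%:R * s%:R.
pose ga : rat := (c%:R + 1) * (b%:R + 1) * s'%:R * t%:R - s'%:R * t'%:R * s%:R * t%:R.
pose D : rat := rising s c * rising s' a * rising t a * rising t' b *
  (superfact a.+1 * superfact b.+1 * superfact c.+1 * superfact (a + b + c).+3 /
  (superfact (a + b).+3 * superfact (b + c).+3 * superfact (a + c).+3)).
(* j * rising j c = rising j c.+1 - c.+1 * rising j c, and likewise for r. *)
have -> : \sum_(j < a.+3) three_tile_formula a b c (a.+2 - j) s t =
   D * (al * (S b c.+1 - c.+1%:R * S b c) + be * (S b.+1 c - b.+1%:R * S b c)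
     + ga * (S b.+1 c.+1 - b.+1%:R * S b c.+1 - c.+1%:R * S b.+1 c
             + b.+1%:R * c.+1%:R * S b c)).
  rewrite /S !mulr_sumr -!sumrN -!big_split /= !mulr_sumr -!big_split /= mulr_sumr.
  apply: eq_bigr => j _; have jK : (j <= K)%N by rewrite -ltnS.
  rewrite /three_tile_formula (subKn jK) -/s' -/t' /D /al /be /ga /factor3 !risingS -/K.
  by rewrite !natrD (natrB _ jK); ring.
(* All the sums are rational multiples of U. *)
pose U := S b c.
have UE : U = b`!%:R * c`!%:R * ((a + b + c).+3)`!%:R / ((a.+2)`!%:R * ((b + c).+1)`!%:R).
  by rewrite /U /S sum_rising /K !addSn.
have -> : S b c.+1 - c.+1%:R * S b c = U * ((c%:R + 1) * (a%:R + 2) / (b%:R + c%:R + 2)).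
  rewrite -/U UE /S sum_rising /K !addnS !addSn !factS !natrM.
  by field; neq0.
have -> : S b.+1 c - b.+1%:R * S b c = U * ((b%:R + 1) * (a%:R + 2) / (b%:R + c%:R + 2)).
  rewrite -/U UE /S sum_rising /K !addnS !addSn !factS !natrM.
  by field; neq0.
have -> : S b.+1 c.+1 - b.+1%:R * S b c.+1 - c.+1%:R * S b.+1 c + b.+1%:R * c.+1%:R * S b c =
    U * ((b%:R + 1) * (c%:R + 1) * (a%:R + 2) * (a%:R + 1) /
         ((b%:R + c%:R + 2) * (b%:R + c%:R + 3))).
  rewrite -/U UE /S !sum_rising /K ?addnS ?addSn !factS !natrM.
  by field; neq0.
rewrite /two_tile_formula !risingS -/s' -/t'.
pose X := rising s c * rising s' a * rising t a * rising t' b.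
set G2 := (X in _ = _ * X * _).
have GU : D * U = X * (G2 * ((b%:R + c%:R + 2) * (b%:R + c%:R + 3) /
    ((a%:R + 1) * (a%:R + 2) * (b%:R + 1) * (c%:R + 1)))).
  rewrite /D -/X -mulrA; congr (_ * _); rewrite UE /G2 ?addnS ?addSn.
  rewrite [(b + c + a)%N]addnC [(b + a)%N]addnC [(c + a)%N]addnC !addnA.
  by rewrite !superfactS !factS !natrM; field; neq0.
transitivity ((X * G2) * ((s + c.+1)%:R * (t' + b.+1)%:R *
    (c.+2%:R * s'%:R + s%:R * t%:R))); last by rewrite /X; ring.
have -> (u v w : rat) : D * (al * (U * u) + be * (U * v) + ga * (U * w)) =
  (D * U) * (al * u + be * v + ga * w) by ring.
rewrite GU -!mulrA; congr (_ * (_ * _)).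
rewrite /al /be /ga /s' /t' !natrD !(natrB _ sb) !(natrB _ tc).
by field; neq0.
Qed.
(** * Solving the linear relations *)

Lemma reaches_first n A (E : nat -> rat) :
  \sum_(j < A.+1) (-1) ^+ j * (reaches n j 0)%:R * E j = E 0%N.
Proof.
rewrite big_ord_recl big1 => [|j _]; first by rewrite /reaches bin0 expr0 !mul1r addr0.
by rewrite /reaches /= mulr0 mul0r.
Qed.

(** Together with [reaches_first]: the boundary values of E are themselves
    coefficients of the product polynomial, namely the outermost ones. *)
Lemma reaches_last n A (E : nat -> rat) :
  \sum_(j < A.+1) (-1) ^+ j * (reaches n j (n + A))%:R * E j = (-1) ^+ A * E A.
Proof.
rewrite big_ord_recr big1 /= => [|j _].
  by rewrite /reaches leq_addl addnK binn mulr1 add0r.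
have jA := ltn_ord j; rewrite /reaches bin_small ?if_same ?mulr0 ?mul0r //; lia.
Qed.

(** The vanishing coefficients of the difference are the w given ones, the last
    one because of N 0 = F 0, and the first one in case c; the sum gives, in case
    b, one more factor 1 + X. *)
Lemma kernel_determined n A d0 w (c b : bool) (N F : nat -> rat) :
    (0 < d0)%N -> (d0 + w <= n + A)%N -> (A < w.+1 + c + b)%N ->
    (forall i, (i < w)%N ->
      \sum_(j < A.+1) (-1) ^+ j * (reaches n j (d0 + i))%:R * N (A - j)%N = 0) ->
    (forall i, (i < w)%N ->
      \sum_(j < A.+1) (-1) ^+ j * (reaches n j (d0 + i))%:R * F (A - j)%N = 0) ->
    N 0%N = F 0%N -> (c -> N A = F A) ->
    (b -> \sum_(j < A.+1) N (A - j)%N = \sum_(j < A.+1) F (A - j)%N) ->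
  forall r, (r <= A)%N -> N r = F r.
Proof.
move=> d0_gt0 d0w szA N0 F0 eq0 eqA eqsum r rA.
pose E j := N (A - j)%N - F (A - j)%N.
pose Z := (n + A)%N :: (if c then [:: 0%N] else [::]) ++ iota d0 w.
have uZ : uniq Z.
  rewrite /= cat_uniq iota_uniq mem_cat mem_iota (_ : uniq _); last by case: (c).
  rewrite andbT; apply/andP; split.
    by rewrite negb_or; case: (c); rewrite ?inE ?in_nil; lia.
  by apply/hasPn => x; rewrite mem_iota; case: (c); rewrite ?inE ?in_nil //=; lia.
have E0 := @kernel_trivial n A E Z b uZ.
rewrite -[r](subKn rA); apply/eqP; rewrite -subr_eq0; apply/eqP.
apply: (E0 _ _ _ _ (leq_subr r A)).
- by rewrite /= size_cat size_iota; case: (c) szA => /=; lia.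
- move=> d; rewrite inE mem_cat mem_iota => /or3P[/eqP->|dc|/andP[d0d dw]].
  + by rewrite reaches_last /E subnn eq0 subrr mulr0.
  + case: (c) dc eqA => //; rewrite inE => /eqP-> /(_ isT) eqA.
    by rewrite reaches_first /E subn0 eqA subrr.
  split; first by lia.
  have iw : (d - d0 < w)%N by lia.
  have := congr2 (fun x y => x - y) (N0 _ iw) (F0 _ iw); rewrite subnKC //= subrr => EE.
  rewrite -[RHS]EE -sumrB; apply: eq_bigr => j _; rewrite /E; ring.
- by move=> /eqsum sE; rewrite sumrB sE subrr.
Qed.

Lemma poly_quadratic (u v w : rat) : {q : {poly rat} | (size q <= 3 - (w == 0)%R)%N &
  forall j : nat, q.[j%:R] = u + v * j%:R + w * j%:R ^+ 2}.
Proof.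
have [->|_] := eqVneq w 0.
  exists (Poly [:: u; v]) => [|j]; first exact: size_Poly.
  by rewrite horner_Poly /=; ring.
exists (Poly [:: u; v; w]) => [|j]; first exact: size_Poly.
by rewrite horner_Poly /=; ring.
Qed.

Lemma rising_kernel_le beta gamma d e f n A m (q : {poly rat}) : (size q <= m)%N ->
    (d + e = beta + A)%N -> (n + f = d + gamma)%N -> (m + e + f <= A)%N ->
  \sum_(j < A.+1) (-1) ^+ j * (reaches n j d)%:R *
    (rising (A - j) beta * rising j gamma * q.[j%:R]) = 0.
Proof.
move=> qm de nf mA; apply: rising_kernel de nf _; apply: leq_trans mA.
by rewrite -!addnA leq_add2r.
Qed.

(** All A rows contribute a relation, and the value at r = 0 is the number of all
    plane partitions in a box with height less by one. *)
Lemma macmahon_step A B C :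
    (#|[set P : 'M['I_C.+1]_(A, B.+1) | plane_partition P]|%:R = box_formula A B.+1 C) ->
  forall r, (r <= A)%N ->
  #|[set P : 'M['I_C.+2]_(A, B.+1) | plane_partition P & zeros P == r]|%:R =
  one_tile_formula A B C r.
Proof.
move=> IH; apply: (@kernel_determined (B + C.+1) A B.+1 A false false
  (fun r => #|[set P : 'M['I_C.+2]_(A, B.+1) | plane_partition P & zeros P == r]|%:R)) => //.
- by lia.
- by lia.
- by move=> i iA; apply: zeros_kernel.
- move=> i iA.
  pose K := superfact A.+1 * superfact B * superfact C * superfact (A + B + C).+1 /
    (superfact (A + B).+1 * superfact (B + C).+1 * superfact (A + C).+1).
  (* e = A - 1 - i and f = i: the degrees add up to A - 1. *)
  rewrite -[RHS](@rising_kernel_le B C (B.+1 + i) (A.-1 - i) i (B + C.+1) A 1 K%:P); try lia;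
    last exact: size_polyC_leq1.
  by apply: eq_bigr => j _; rewrite hornerC /one_tile_formula subKn // -ltnS.
rewrite one_tile_formula_0 -IH; congr _%:R.
transitivity #|[set P : 'M['I_C.+2]_(A, B.+1) |
   [&& plane_partition P, zeros P == 0%N & predT P]]|.
  by apply: eq_card => P; rewrite !inE andbT.
by rewrite card_no_zeros; apply: eq_card => P; rewrite !inE andbT.
Qed.

(** By induction on the height: r = 0 in the formula of [macmahon_step] takes
    its value from height C, and r = A yields the value for height C + 1, with
    one column less. *)
Theorem macmahon A B C :
  #|[set P : 'M['I_C.+1]_(A, B) | plane_partition P]|%:R = box_formula A B C.
Proof.
elim: C A B => [|C IHC] A B.
  rewrite /box_formula (_ : [set P | _] = [set const_mx ord0]).
    rewrite cards1 !addn0 {3}/superfact big_geq //; field; neq0.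
  apply/setP => P; rewrite !inE; apply/idP/eqP => [_|->].
    by apply/matrixP => i j; rewrite mxE; apply: val_inj; case: (P i j) => -[].
  by apply/plane_partitionP; split=> *; rewrite !mxE.
rewrite -one_tile_formula_top -(macmahon_step (IHC A B.+1) (leqnn A)); congr _%:R.
transitivity #|[set P : 'M['I_C.+2]_(A, B.+1) |
   [&& plane_partition P, zeros P == A & predT P]]|; last first.
  by apply: eq_card => P; rewrite !inE andbT.
by rewrite card_all_zeros; apply: eq_card => P; rewrite !inE andbT.
Qed.

Theorem card_zeros A B C r : (r <= A)%N ->
  #|[set P : 'M['I_C.+2]_(A, B.+1) | plane_partition P & zeros P == r]|%:R =
  one_tile_formula A B C r.
Proof. exact: macmahon_step (macmahon _ _ _) r. Qed.

Theorem card_tops A B C s : (s <= B)%N ->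
  #|[set P : 'M['I_C.+2]_(A.+1, B) | plane_partition P & tops P == (B - s)%N]|%:R =
  one_tile_formula B C A s.
Proof.
move=> sB; rewrite -card_zeros //; congr _%:R; apply: card_rotate => P Ppp.
rewrite zeros_rotate //; have : (tops P <= B)%N.
  by rewrite -[X in (_ <= X)%N]card_ord max_card.
by move=> tB; apply/eqP/eqP; lia.
Qed.

(** The first row is constrained, so A of the A + 1 rows contribute; the values at
    r = 0 and r = A + 1 are counts by [tops] alone. *)
Theorem card_zeros_tops A B C r s : (r <= A.+1)%N -> (s <= B.+1)%N ->
  #|[set P : 'M['I_C.+3]_(A.+1, B.+1) |
     [&& plane_partition P, zeros P == r & tops P == (B.+1 - s)%N]]|%:R =
  two_tile_formula A B C r s.
Proof.
move=> rA sB; move: r rA.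
apply: (@kernel_determined (B + C.+2) A.+1 B.+2 A true false
  (fun r => #|[set P : 'M['I_C.+3]_(A.+1, B.+1) |
     [&& plane_partition P, zeros P == r & tops P == (B.+1 - s)%N]]|%:R)
  (fun r => two_tile_formula A B C r s)) => //.
- by lia.
- by lia.
- by move=> i iA; rewrite addSnnS; apply: zeros_tops_kernel.
- move=> i iA.
  pose K := rising s C * rising (B.+1 - s) A *
    (superfact A.+1 * superfact B.+1 * superfact C * superfact (A + B + C).+2 /
    (superfact (A + B).+2 * superfact (B + C).+2 * superfact (A + C).+2)).
  have [q + qE] := poly_quadratic (K * (A.+1%:R * s%:R)) (K * (B.+1%:R - s%:R)) 0.
  rewrite eqxx => /= sq.
  rewrite -[RHS](@rising_kernel_le B C (B.+2 + i) (A.-1 - i) i (B + C.+2) A.+1 2 q) //; try lia.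
  apply: eq_bigr => j _; have jA : (j <= A.+1)%N by rewrite -ltnS.
  by rewrite /two_tile_formula subKn // qE /K natrB //; ring.
- rewrite two_tile_formula_0 // -card_tops //; congr _%:R.
  by rewrite card_no_zeros; apply: eq_card => P; rewrite !inE tops_raise.
- move=> _; rewrite card_all_zeros.
  have -> : #|[set P : 'M['I_C.+3]_(A.+1, B) | plane_partition P &
      tops (add_column P) == (B.+1 - s)%N]| =
    #|[set P : 'M['I_C.+3]_(A.+1, B) | plane_partition P & tops P == (B.+1 - s)%N]|.
    by apply: eq_card => P; rewrite !inE tops_add_column.
  case: s sB => [|s] sB; last by rewrite two_tile_formula_top // -card_tops // subSS.
  rewrite two_tile_formula_top0 eq_card0 // => P; rewrite !inE subn0.
  have : (tops P <= B)%N by rewrite -[X in (_ <= X)%N]card_ord max_card.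
  by move=> tB; rewrite andbC; case: eqP => // tE; rewrite tE ltnn in tB.
Qed.

Theorem card_tops_corner A B C s t : (s <= B.+1)%N -> (t <= C.+1)%N ->
  #|[set P : 'M['I_C.+2]_(A.+2, B.+1) | [&& plane_partition P, tops P == (B.+1 - s)%N &
      P ord_max ord0 == (C.+1 - t)%N :> nat]]|%:R = two_tile_formula B C A s t.
Proof.
move=> sB tC; rewrite -card_zeros_tops //; congr _%:R; apply: card_rotate => P Ppp.
rewrite zeros_rotate // tops_rotate //; congr (_ && _).
have : (tops P <= B.+1)%N by rewrite -[X in (_ <= X)%N]card_ord max_card.
by move=> tB; apply/eqP/eqP; lia.
Qed.
(** Only the a middle rows contribute; the values at r = 0 and r = a + 2
    and the sum over r are counts by [tops] and the bottom-left entry. *)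
Theorem card_zeros_tops_corner a b c r s t :
    (r <= a.+2)%N -> (s <= b.+2)%N -> (t <= c.+2)%N ->
  #|[set P : 'M['I_c.+3]_(a.+2, b.+2) |
     [&& plane_partition P, zeros P == r, tops P == (b.+2 - s)%N &
      P ord_max ord0 == (c.+2 - t)%N :> nat]]|%:R = three_tile_formula a b c r s t.
Proof.
move=> rA sb tc; move: r rA.
apply: (@kernel_determined (b.+1 + c.+2) a.+2 b.+3 a true true
  (fun r => #|[set P : 'M['I_c.+3]_(a.+2, b.+2) |
     [&& plane_partition P, zeros P == r, tops P == (b.+2 - s)%N &
      P ord_max ord0 == (c.+2 - t)%N :> nat]]|%:R)
  (fun r => three_tile_formula a b c r s t)) => //.
- by lia.
- by lia.
- move=> i ia; rewrite [(b.+3 + i)%N]addSnnS.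
  by apply: zeros_tops_corner_kernel => //; apply: leq_subr.
- move=> i ia; pose s' := (b.+2 - s)%N; pose t' := (c.+2 - t)%N.
  pose K : rat := rising s c * rising s' a * rising t a * rising t' b *
    (superfact a.+1 * superfact b.+1 * superfact c.+1 * superfact (a + b + c).+3 /
    (superfact (a + b).+3 * superfact (b + c).+3 * superfact (a + c).+3)).
  (* The factor of the formula as a quadratic polynomial in j = a + 2 - r. *)
  pose al : rat := (a%:R + 1) * (b%:R + 1) * (c%:R + 1) * s'%:R * t'%:R
    + (b%:R + 1) * (a%:R + 1) * t'%:R * s%:R * t%:R.
  pose be : rat := (a%:R + 1) * (b%:R + 1) * (c%:R + 1) * s%:R * t%:R
    + (a%:R + 1) * (c%:R + 1) * s'%:R * t'%:R * s%:R.
  pose ga : rat := (c%:R + 1) * (b%:R + 1) * s'%:R * t%:R - s'%:R * t'%:R * s%:R * t%:R.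
  have [q + qE] := poly_quadratic (K * (be * a.+2%:R))
    (K * (al - be + ga * a.+2%:R)) (K * - ga).
  move=> /leq_trans/(_ (leq_subr _ _)) sq.
  rewrite -[RHS](@rising_kernel_le b c (b.+3 + i) (a.-1 - i) i
    (b.+1 + c.+2) a.+2 3 q) //; try lia.
  apply: eq_bigr => j _; have ja : (j <= a.+2)%N by rewrite -ltnS.
  rewrite /three_tile_formula subKn // qE /K /al /be /ga /factor3 -/s' -/t' (natrB _ ja).
  set G := superfact _ * _ * _ * _ / _.
  move: (nat_of_ord j)%:R s'%:R t'%:R (rising (a.+2 - j) b) (rising j c) G.
  by move=> x y z u v G; ring.
- have -> : #|[set P : 'M['I_c.+3]_(a.+2, b.+2) | [&& plane_partition P, zeros P == 0%N,
      tops P == (b.+2 - s)%N & P ord_max ord0 == (c.+2 - t)%N :> nat]]| =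
    #|[set P : 'M['I_c.+2]_(a.+2, b.+2) | [&& plane_partition P,
      tops P == (b.+2 - s)%N & (P ord_max ord0).+1 == (c.+2 - t)%N]]|.
    rewrite (@card_no_zeros _ _ _ (fun P => (tops P == (b.+2 - s)%N) &&
      (P ord_max ord0 == (c.+2 - t)%N :> nat))).
    by apply: eq_card => P; rewrite !inE tops_raise mxE lift0.
  have [tc1|ct] := leqP t c.+1.
    rewrite three_tile_formula_0 // -card_tops_corner //; congr _%:R.
    by apply: eq_card => P; rewrite !inE (subSn tc1) eqSS.
  have -> : t = c.+2 by lia.
  rewrite three_tile_formula_0top eq_card0 // => P; rewrite !inE subnn.
  by rewrite !andbF.
- move=> _; rewrite (@card_all_zeros _ _ _ (fun P => (tops P == (b.+2 - s)%N) &&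
      (P ord_max ord0 == (c.+2 - t)%N :> nat))).
  have -> : #|[set P : 'M['I_c.+3]_(a.+2, b.+1) | plane_partition P &
      (tops (add_column P) == (b.+2 - s)%N) &&
      (add_column P ord_max ord0 == (c.+2 - t)%N :> nat)]| =
    #|[set P : 'M['I_c.+3]_(a.+2, b.+1) | [&& plane_partition P, tops P == (b.+2 - s)%N &
      P ord_max ord0 == (c.+2 - t)%N :> nat]]|.
    by apply: eq_card => P; rewrite !inE tops_add_column corner_add_column.
  case: s sb => [|s] sb; last by rewrite three_tile_formula_top // -card_tops_corner // subSS.
  rewrite three_tile_formula_top0 eq_card0 // => P; rewrite !inE subn0.
  have : (tops P <= b.+1)%N by rewrite -[X in (_ <= X)%N]card_ord max_card.
  by move=> tB; case: (tops P =P b.+2) => [tE|]; rewrite ?andbF //; rewrite tE ltnn in tB.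
move=> _; rewrite sum_three_tile_formula // -card_tops_corner // -natr_sum; congr _%:R.
rewrite -sum1_card.
rewrite (partition_big (fun P => inord (a.+2 - zeros P)) (fun j : 'I_a.+3 => true)) //=.
apply: eq_bigr => j _; rewrite sum1dep_card; apply: eq_card => P; rewrite !inE.
have zP := zeros_le P; have ja : (j <= a.+2)%N by rewrite -ltnS.
case: (plane_partition P) => //=; rewrite andbC; congr (_ && _).
apply/eqP/eqP => [->|<-]; last by rewrite inordK ?subKn // ltnS leq_subr.
by rewrite subKn // inord_val.
Qed.
Lemma pochhammer_rising m n (x : rat) : x = m%:R + 1 -> pochhammer x n = rising m n.
Proof.
move=> ->; elim: n => [|n IHn].
  by rewrite /pochhammer big_ord0 /rising addn0 divff ?factr_neq0.
rewrite risingS -IHn /pochhammer big_ord_recr /= mulrC natrD -natr1; congr (_ * _); ring.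
Qed.

Theorem corollary3 (a b c r s t : nat)
    (hr : (r <= a + 2)%N) (hs : (s <= b + 2)%N) (ht : (t <= c + 2)%N) :
  #|[set P : 'M['I_(c.+2).+1]_(a.+2, b.+2) |
      [&& plane_partition P,
          #|[set j : 'I_b.+2 | P ord0 j == (c + 2)%N :> nat]| == (b + 2 - s)%N,
          #|[set i : 'I_a.+2 | P i ord_max == 0%N :> nat]| == r &
          P ord_max ord0 == (c + 2 - t)%N :> nat]]|%:R
  = pochhammer (r%:R + 1) b * pochhammer (s%:R + 1) c
    * pochhammer (t%:R + 1) a * pochhammer (c%:R + 3 - t%:R) b
    * pochhammer (a%:R + 3 - r%:R) c * pochhammer (b%:R + 3 - s%:R) a
    * ((\prod_(0 <= k < a.+1) (k`!)%:R) * (\prod_(0 <= k < b.+1) (k`!)%:R)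
       * (\prod_(0 <= k < c.+1) (k`!)%:R)
       * (\prod_(0 <= k < (a + b + c + 2).+1) (k`!)%:R)
       / ((\prod_(0 <= k < (b + c + 2).+1) (k`!)%:R)
          * (\prod_(0 <= k < (a + c + 2).+1) (k`!)%:R)
          * (\prod_(0 <= k < (a + b + 2).+1) (k`!)%:R)))
    * ((a%:R + 1) * (b%:R + 1) * (c%:R + 1)
         * (a%:R + 2 - r%:R) * (b%:R + 2 - s%:R) * (c%:R + 2 - t%:R)
       + (a%:R + 1) * (b%:R + 1) * (c%:R + 1) * (r%:R * s%:R * t%:R)
       - (a%:R + 2 - r%:R) * (b%:R + 2 - s%:R) * (c%:R + 2 - t%:R)
         * (r%:R * s%:R * t%:R)
       + (a%:R + 1) * (c%:R + 1) * (b%:R + 2 - s%:R) * (c%:R + 2 - t%:R)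
         * (r%:R * s%:R)
       + (b%:R + 1) * (a%:R + 1) * (c%:R + 2 - t%:R) * (a%:R + 2 - r%:R)
         * (s%:R * t%:R)
       + (c%:R + 1) * (b%:R + 1) * (a%:R + 2 - r%:R) * (b%:R + 2 - s%:R)
         * (t%:R * r%:R)) :> rat.
Proof.
set X := #|_|.
have ra : (r <= a.+2)%N by rewrite -addn2.
have sb : (s <= b.+2)%N by rewrite -addn2.
have tc : (t <= c.+2)%N by rewrite -addn2.
have -> : X%:R = three_tile_formula a b c r s t.
  rewrite -(card_zeros_tops_corner ra sb tc) /X; congr _%:R.
  by apply: eq_card => P; rewrite !inE /zeros /tops !addn2; congr (_ && _); rewrite andbCA.
rewrite (@pochhammer_rising r) // (@pochhammer_rising s) // (@pochhammer_rising t) //.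
have top (m n : nat) : (n <= m.+2)%N -> m%:R + 3 - n%:R = (m.+2 - n)%N%:R + 1 :> rat.
  by move=> nm; rewrite natrB //; ring.
have sub2 (m n : nat) : (n <= m.+2)%N -> m%:R + 2 - n%:R = (m.+2 - n)%N%:R :> rat.
  by move=> nm; rewrite natrB //; ring.
rewrite (pochhammer_rising _ (top _ _ tc)) (pochhammer_rising _ (top _ _ ra)).
rewrite (pochhammer_rising _ (top _ _ sb)) !sub2 // -!/(superfact _) !addn2.
have -> : superfact (b + c).+3 * superfact (a + c).+3 * superfact (a + b).+3 =
  superfact (a + b).+3 * superfact (b + c).+3 * superfact (a + c).+3 by ring.
rewrite /three_tile_formula /factor3.
set G := (X in _ * X * _ = _).
set G' := (X in _ = _ * X * _).
have -> : G' = G by [].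
by move: G (rising r b) (rising s c) (rising t a) => G u v w; ring.
Qed.
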